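(* Let $H$ be a forest with connected components the trees $T_1,\dots,T_k$, and let $b$ be a positive integer. Consider $(1:b)$ Client-Waiter vertex games. (1) If $H$ is a tree ($k=1$), there exists a tree $T$ such that Client wins the $(1:b)$ Client-Waiter vertex $H$-game played on $T$. (2) For each $i\in[k]$ let $T^{(i)}_{\min}$ be a tree with the minimum number of vertices such that Client wins the $(1:b)$ Client-Waiter vertex $T_i$-game played on it, and let $T_{\max}$ be one of the trees $T^{(i)}_{\min}$ with the maximum number of vertices; write $v=v(T_{\max})$, $e=e(T_{\max})$. Then for $G\sim G(n,p)$: if $p=\omega(n^{-v/e})$ then w.h.p. Client wins the $(1:b)$ Client-Waiter vertex $H$-game on $G$, and if $p=o(n^{-v/e})$ then w.h.p. Waiter wins it.
   Context: The $(1:b)$ Client-Waiter vertex $H$-game on a graph $G$: in each round Waiter offers a set of $t$ previously unclaimed vertices with $1\le t\le b+1$; Client claims one of them and Waiter claims the rest; in the last round Client claims one of the remaining vertices and Waiter the rest. Client wins if the subgraph of $G$ induced by his vertices contains a (not necessarily induced) copy of $H$; otherwise Waiter wins. $G(n,p)$ is the binomial random graph; ''w.h.p.'' means with probability tending to 1 as $n\to\infty$.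
   Formalization: Part (2) is stated for forests H with at least one edge; for an edgeless H every minimal tree is a single vertex, so e(T_max)=0 and n^{-v/e} is undefined. *)

(* Defs.v *)
From Stdlib Require Import Reals.
From mathcomp Require Import all_boot.
Set Implicit Arguments. Unset Strict Implicit. Unset Printing Implicit Defensive.

Definition simple_graph (V : finType) (e : rel V) : Prop :=
  (forall x y, e x y = e y x) /\ (forall x, e x x = false).

Definition has_cycle (V : finType) (e : rel V) : Prop :=
  exists s : seq V, [/\ uniq s, 3 <= size s & cycle e s].

Definition is_forest (V : finType) (e : rel V) : Prop :=
  simple_graph e /\ ~ has_cycle e.

Definition is_tree (V : finType) (e : rel V) : Prop :=
  is_forest e /\ 0 < #|V| /\ (forall x y, connect e x y).

Definition nedges (V : finType) (e : rel V) : nat :=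
  #|[set p : V * V | e p.1 p.2]| %/ 2.

Definition component (V : finType) (e : rel V) (x : V) : {set V} :=
  [set y | connect e x y].

(* The host graph (VG, eG) restricted to the vertex set C contains a (not
   necessarily induced) copy of the subgraph of (VH, eH) induced on A. *)
Definition has_copy (VH : finType) (eH : rel VH) (A : {set VH})
    (VG : finType) (eG : rel VG) (C : {set VG}) : bool :=
  [exists f : {ffun VH -> VG},
     [forall x in A, f x \in C] &&
     [forall x in A, forall y in A,
        ((f x == f y) ==> (x == y)) && (eH x y ==> eG (f x) (f y))]].

(* (1:b) Client-Waiter vertex game.  State: Client's vertices C, free vertices F.
   While F is nonempty, Waiter offers O ⊆ F with 1 <= |O| <= b+1, Client claims
   one x ∈ O and Waiter claims O \ {x}.  Client wins iff at the end his
   vertices contain a copy of the target.  [fuel] bounds the number of rounds. *)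
Fixpoint cw_client_wins (b : nat) (VH : finType) (eH : rel VH) (A : {set VH})
    (VG : finType) (eG : rel VG) (fuel : nat) (C F : {set VG}) : bool :=
  match fuel with
  | 0 => has_copy eH A eG C
  | fuel'.+1 =>
      if F == set0 then has_copy eH A eG C
      else [forall O : {set VG},
              ((O \subset F) && (0 < #|O| <= b.+1)) ==>
              [exists x in O, cw_client_wins b eH A eG fuel' (x |: C) (F :\: O)]]
  end.

Definition client_wins (b : nat) (VH : finType) (eH : rel VH) (A : {set VH})
    (VG : finType) (eG : rel VG) : bool :=
  cw_client_wins b eH A eG #|VG| set0 setT.

Definition min_winning_tree (b : nat) (VH : finType) (eH : rel VH) (A : {set VH})
    (VT : finType) (eT : rel VT) : Prop :=
  [/\ is_tree eT, client_wins b eH A eT &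
      forall (VT' : finType) (eT' : rel VT'),
        is_tree eT' -> client_wins b eH A eT' -> #|VT| <= #|VT'| ].

Definition epair (n : nat) := {p : 'I_n * 'I_n | (p.1 < p.2)%N}.

Definition gadj (n : nat) (E : {set epair n}) : rel 'I_n :=
  fun i j => [exists u in E,
                (((val u).1 == i) && ((val u).2 == j)) ||
                (((val u).1 == j) && ((val u).2 == i))].

Definition gnp_prob (n : nat) (p : R) (Q : pred {set epair n}) : R :=
  \big[Rplus/R0]_(E : {set epair n} | Q E)
     Rmult (pow p #|E|) (pow (Rminus R1 p) (subn #|[set: epair n]| #|E|)).

Definition whp (Q : forall n : nat, pred {set epair n}) (p : nat -> R) : Prop :=
  Un_cv (fun n => @gnp_prob n (p n) (Q n)) R1.

Definition little_omega (p f : nat -> R) : Prop :=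
  forall M : R, Rlt R0 M ->
    exists N : nat, forall n, (N <= n)%nat -> Rle (Rmult M (f n)) (p n).
Definition little_o (p f : nat -> R) : Prop :=
  forall eps : R, Rlt R0 eps ->
    exists N : nat, forall n, (N <= n)%nat -> Rle (p n) (Rmult eps (f n)).

Definition threshold (v e : nat) : nat -> R :=
  fun n => Rpower (INR n) (Ropp (Rdiv (INR v) (INR e))).

Definition prob_bounds (p : nat -> R) : Prop :=
  forall n, Rle R0 (p n) /\ Rle (p n) R1.

(* Main.v *)
Require Import Defs.
From Stdlib Require Import Reals Classical.
From mathcomp Require Import all_boot all_order all_algebra.
From mathcomp Require Import zify ring.
From mathcomp Require Import Rstruct.
Set Implicit Arguments. Unset Strict Implicit. Unset Printing Implicit Defensive.

(** A winning tree for H grows with H.  If Client wins the game of H - x on T, where x is a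
    leaf of H, attach many new leaves to every vertex of T.  Client answers inside T
    whenever T is touched; this takes a bounded number of rounds, so that he can still
    claim a new leaf at every vertex of T, and one of these extends his copy of H - x.

    If p << n^(-v/(v-1)), a first moment computation shows that w.h.p. every component of
    G(n,p) is a tree with fewer than v vertices.  Waiter plays on the components one by
    one, and by the minimality of v Client gets a copy of the critical component of H in
    none of them.

    If p >> n^(-v/(v-1)), a second moment computation yields any constant number of
    disjoint copies of a minimum winning tree of every component of H.  Offers may meet
    several of these boards at once.  Let a board that Client still wins weigh
    (b+1)^(number of Client's vertices in it).  An answer in the heaviest touched board
    does not decrease the total weight, whereas an answer forced elsewhere costs a bounded
    amount; taking many more boards for each next component, Client wins on some board of
    every component. *)

(** * The game *)

Definition monotone (V : finType) (W : pred {set V}) : Prop :=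
  forall C C' : {set V}, C \subset C' -> W C -> W C'.

Definition offer (b : nat) (V : finType) (F O : {set V}) : bool :=
  (O \subset F) && (0 < #|O| <= b.+1).

Fixpoint forces_within (b : nat) (V : finType) (W : pred {set V}) (fuel : nat)
    (C F : {set V}) : bool :=
  match fuel with
  | 0 => W C
  | fuel'.+1 =>
      if F == set0 then W C
      else [forall O : {set V}, offer b F O ==>
              [exists x in O, forces_within b W fuel' (x |: C) (F :\: O)]]
  end.

(* Every round uses up a free vertex, so that #|F| is enough fuel. *)
Definition forces (b : nat) (V : finType) (W : pred {set V}) (C F : {set V}) : bool :=
  forces_within b W #|F| C F.

Definition forces_on (b : nat) (V : finType) (W : pred {set V}) (D C F : {set V}) : bool :=
  forces b W (C :&: D) (F :&: D).

Lemma client_winsE (b : nat) (VH : finType) (eH : rel VH) (A : {set VH})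
    (VG : finType) (eG : rel VG) :
  client_wins b eH A eG = forces b (has_copy eH A eG) set0 setT.
Proof.
have cw_forces n C F :
    cw_client_wins b eH A eG n C F = forces_within b (has_copy eH A eG) n C F.
  elim: n C F => //= n IH C F; case: ifP => // _; apply: eq_forallb => O.
  by congr (_ ==> _); apply: eq_existsb => x; rewrite IH.
by rewrite /client_wins /forces cw_forces cardsT.
Qed.

Section Game.
Context {b : nat} {V : finType}.
Implicit Types (W : pred {set V}) (C D F O X : {set V}) (x : V).

Lemma offer_neq0 F O : offer b F O -> F != set0.
Proof.
case/andP => sOF /andP[O0 _]; rewrite -card_gt0.
exact: leq_trans O0 (subset_leq_card sOF).
Qed.

Lemma offer_set1 F x : x \in F -> offer b F [set x].
Proof. by move=> xF; rewrite /offer sub1set xF cards1. Qed.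

Lemma ltn_card_offer F O : offer b F O -> #|F :\: O| < #|F|.
Proof.
by case/andP => sOF /andP[O0 _]; have := subset_leq_card sOF; rewrite cardsDS //; lia.
Qed.

Lemma offerI D F O : offer b F O -> O :&: D != set0 -> offer b (F :&: D) (O :&: D).
Proof.
case/andP => sOF /andP[_ Ob] OD0; rewrite /offer setSI //= card_gt0 OD0 /=.
exact: leq_trans (subset_leq_card (subsetIl _ _)) Ob.
Qed.

Lemma forces_within_fuel W n m C F :
  #|F| <= n -> #|F| <= m -> forces_within b W n C F = forces_within b W m C F.
Proof.
elim: n m C F => [|n IH] [|m] C F //=; rewrite ?leqn0 ?cards_eq0.
- by move=> ->.
- by move=> _ ->.
move=> Fn Fm; case: eqP => // _; apply: eq_forallb => O.
have [/ltn_card_offer lt_F|//] := boolP (offer b F O); congr (_ ==> _).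
by apply: eq_existsb => x; congr andb; apply: IH; lia.
Qed.

Lemma forces_end W C : forces b W C set0 = W C.
Proof. by rewrite /forces cards0. Qed.

Lemma forcesP W C F : F != set0 ->
  reflect (forall O, offer b F O -> exists2 x, x \in O & forces b W (x |: C) (F :\: O))
          (forces b W C F).
Proof.
move=> F0; have fuel_eq O x : offer b F O ->
    forces_within b W #|F|.-1 (x |: C) (F :\: O) = forces b W (x |: C) (F :\: O).
  by move=> /ltn_card_offer lt_F; apply: forces_within_fuel => //; lia.
have F_gt0 : #|F|.-1.+1 = #|F| by rewrite prednK // card_gt0.
rewrite /forces -{1}F_gt0 /= (negPf F0).
apply: (iffP forallP) => reply O => [offO|].
  have /implyP/(_ offO)/exists_inP[x xO] := reply O.
  by rewrite fuel_eq //; exists x.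
apply/implyP => offO; have [x xO win_x] := reply O offO.
by apply/exists_inP; exists x; rewrite ?fuel_eq.
Qed.

Lemma forcesPn W C F : F != set0 ->
  reflect (exists2 O, offer b F O & forall x, x \in O -> ~~ forces b W (x |: C) (F :\: O))
          (~~ forces b W C F).
Proof.
move=> F0; apply: (iffP idP) => [lose|[O offO lose]]; last first.
  apply/negP => /(forcesP _ _ F0)/(_ O offO)[x xO]; apply/negP; exact: lose.
case: (pickP [pred O | offer b F O &
         [forall x in O, ~~ forces b W (x |: C) (F :\: O)]]) => [O|none].
  by case/andP => offO /forall_inP; exists O.
case/negP: lose; apply/(forcesP _ _ F0) => O offO.
have := none O; rewrite /= offO => /negbT; rewrite negb_forall_in.
by case/exists_inP => x xO; rewrite negbK; exists x.
Qed.

Lemma forces_reply W C F O : forces b W C F -> offer b F O ->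
  exists2 x, x \in O & forces b W (x |: C) (F :\: O).
Proof. by move=> win offO; move/(forcesP _ _ (offer_neq0 offO)): win; apply. Qed.

Lemma forces_invariant (I : {set V} -> {set V} -> Prop) W C F :
  (forall C, I C set0 -> W C) ->
  (forall C F O, I C F -> offer b F O -> exists2 x, x \in O & I (x |: C) (F :\: O)) ->
  I C F -> forces b W C F.
Proof.
move=> I_end I_step; have [n] := ubnP #|F|; elim: n C F => // n IH C F Fn ICF.
have [F0|F0] := eqVneq F set0; first by rewrite F0 forces_end; apply: I_end; rewrite -F0.
apply/forcesP => // O offO; have [x xO Ix] := I_step _ _ _ ICF offO.
by exists x => //; apply: IH Ix; have := ltn_card_offer offO; lia.
Qed.

Lemma forces_sub W W' C F :
  (forall C', W C' -> W' C') -> forces b W C F -> forces b W' C F.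
Proof.
move=> sWW'; apply: (forces_invariant (I := forces b W)) => [C'|C' F' O].
  by rewrite forces_end => /sWW'.
exact: forces_reply.
Qed.

Lemma forces_attainable W C F : forces b W C F -> exists C', W C'.
Proof.
have [n] := ubnP #|F|; elim: n C F => // n IH C F Fn.
have [->|/set0Pn[y /offer_set1 offy]] := eqVneq F set0; first by rewrite forces_end; exists C.
case/forces_reply/(_ offy) => x _; apply: IH.
by have := ltn_card_offer offy; lia.
Qed.

Lemma forces_set1 x : forces b (fun C => x \in C) set0 [set x].
Proof.
apply/forcesP => [|O]; first by rewrite -card_gt0 cards1.
case/andP; rewrite subset1 => /orP[/eqP-> _|/eqP->]; last by rewrite cards0.
by exists x; rewrite ?setDv ?forces_end !inE eqxx.
Qed.

Lemma setU1I_in (D C : {set V}) x : x \in D -> (x |: C) :&: D = x |: (C :&: D).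
Proof. by move=> xD; rewrite setIUl (setIidPl _) ?sub1set. Qed.

Lemma setU1I_out (D C : {set V}) x : x \notin D -> (x |: C) :&: D = C :&: D.
Proof.
move=> xD; rewrite setIUl (_ : _ :&: _ = set0) ?set0U //.
by apply/eqP; rewrite setI_eq0 disjoints1.
Qed.

Lemma setDI_distrl (D F O : {set V}) : (F :\: O) :&: D = (F :&: D) :\: (O :&: D).
Proof.
rewrite setIDAC setDIr [_ :\: D](_ : _ = set0) ?setU0 //.
by apply/eqP; rewrite setD_eq0 subsetIr.
Qed.

Lemma forces_on_reply W D C F O : forces_on b W D C F -> offer b F O -> O :&: D != set0 ->
  exists2 x, x \in O :&: D & forces_on b W D (x |: C) (F :\: O).
Proof.
move=> win offO OD0; have [x xOD win_x] := forces_reply win (offerI offO OD0).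
exists x => //; have [_ xD] := setIP xOD.
by rewrite /forces_on setDI_distrl setU1I_in.
Qed.

Lemma forces_on_untouched W D C F O x : x \in O -> O :&: D = set0 ->
  forces_on b W D (x |: C) (F :\: O) = forces_on b W D C F.
Proof.
move=> xO OD0; rewrite /forces_on setDI_distrl OD0 setD0 setU1I_out //.
by apply/negP => xD; move/setP/(_ x): OD0; rewrite !inE xO xD.
Qed.

Lemma forces_on_start W D X : D \subset X -> forces_on b W D set0 X = forces b W set0 D.
Proof. by move=> DX; rewrite /forces_on set0I (setIidPr DX). Qed.

Lemma forces_superset W D X : monotone W -> D \subset X ->
  forces b W set0 D -> forces b W set0 X.
Proof.
move=> monoW DX; rewrite -(forces_on_start _ DX).
apply: (forces_invariant (I := forces_on b W D)) => [C|C F O win offO].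
  by rewrite /forces_on set0I forces_end; apply/monoW/subsetIl.
have [OD0|OD0] := eqVneq (O :&: D) set0; last first.
  by have [x /setIP[xO _] win_x] := forces_on_reply win offO OD0; exists x.
have [_ /andP[/card_gt0P[x xO] _]] := andP offO.
by exists x; rewrite ?forces_on_untouched.
Qed.

(* Waiter plays on the classes of r one after the other. *)
Lemma forces_class (K : finType) (r : V -> K) W C F :
  (forall C', W C' -> exists k, W (C' :&: r @^-1: [set k])) ->
  forces b W C F -> exists k, forces_on b W (r @^-1: [set k]) C F.
Proof.
move=> W_local; have [n] := ubnP #|F|; elim: n C F => // n IH C F Fn win.
have [F0|/set0Pn[y yF]] := eqVneq F set0.
  move: win; rewrite F0 forces_end => /W_local[k Wk]; exists k.
  by rewrite /forces_on set0I forces_end.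
pose D := r @^-1: [set r y].
have [winD|loseD] := boolP (forces_on b W D C F); first by exists (r y).
have FD0 : F :&: D != set0 by apply/set0Pn; exists y; rewrite !inE yF eqxx.
have [O /andP[sOFD Ob] lose] := forcesPn _ _ FD0 loseD.
have [sOF sOD] := (subset_trans sOFD (subsetIl _ _), subset_trans sOFD (subsetIr _ _)).
have offO : offer b F O by rewrite /offer sOF.
have [x xO win_x] := forces_reply win offO.
have [|k win_k] := IH _ _ _ win_x; first by have := ltn_card_offer offO; lia.
exists k; have [k_ry|k_ry] := eqVneq k (r y).
  case/negP: (lose x xO); move: win_k; rewrite k_ry /forces_on setDI_distrl.
  by rewrite setU1I_in ?(subsetP sOD) // (setIidPl sOD).
rewrite -(forces_on_untouched _ _ _ xO) //; apply/eqP; rewrite setI_eq0.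
apply: disjointWl sOD _; rewrite -setI_eq0; apply/eqP/setP => z; rewrite !inE.
by case: (eqVneq (r z)) => //= ->; rewrite eq_sym (negPf k_ry).
Qed.

End Game.

Section Imset.
Context {b : nat} {U V : finType} {f : U -> V}.
Hypothesis injf : injective f.
Implicit Types (A B C F O : {set U}).

Lemma imset_setD_inj A B : f @: (A :\: B) = f @: A :\: f @: B.
Proof.
apply/setP => y; apply/imsetP/setDP => [[x /setDP[xA xB] ->]|[/imsetP[x xA ->]]].
  by rewrite !mem_imset.
by rewrite mem_imset // => xB; exists x; rewrite // inE xB.
Qed.

Lemma offer_imset F O : offer b (f @: F) (f @: O) = offer b F O.
Proof.
rewrite /offer card_imset //; congr andb; apply/subsetP/subsetP => sO x.
  by move=> /(imset_f f)/sO; rewrite mem_imset.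
by case/imsetP => y /sO yF ->; rewrite imset_f.
Qed.

Lemma forces_imset (W : pred {set V}) C F :
  forces b W (f @: C) (f @: F) = forces b (fun C' => W (f @: C')) C F.
Proof.
have [n] := ubnP #|F|; elim: n C F => // n IH C F Fn.
have [->|F0] := eqVneq F set0; first by rewrite imset0 !forces_end.
have fF0 : f @: F != set0 by rewrite imset_eq0.
have reply_imset O x : offer b F O ->
    forces b W (f x |: f @: C) (f @: F :\: f @: O) =
    forces b (fun C' => W (f @: C')) (x |: C) (F :\: O).
  by move=> /ltn_card_offer lt_F; rewrite -imsetU1 -imset_setD_inj IH //; lia.
apply/(forcesP _ _ fF0)/(forcesP _ _ F0) => reply O offO.
  have [|_ /imsetP[x xO ->]] := reply (f @: O); first by rewrite offer_imset.
  by rewrite reply_imset //; exists x.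
have im_preim : O = f @: (f @^-1: O).
  apply/setP => y; apply/idP/imsetP => [yO|[x + ->]]; last by rewrite inE.
  have [/subsetP/(_ y yO)/imsetP[x _ yx] _] := andP offO.
  by exists x; rewrite // inE -yx.
move: offO; rewrite im_preim offer_imset => offO; have [x xO win_x] := reply _ offO.
by exists (f x); rewrite ?imset_f ?reply_imset.
Qed.

End Imset.

(** * Weighted boards *)

Definition board_family (b v : nat) (V I : finType) (B : I -> {set V})
    (W : I -> pred {set V}) : Prop :=
  (forall i j, i != j -> [disjoint B i & B j]) /\
  (forall i, [/\ #|B i| <= v, monotone (W i) & forces b (W i) set0 (B i)]).

Definition touched (V I : finType) (B : I -> {set V}) (O : {set V}) : {set I} :=
  [set i | O :&: B i != set0].

Definition board_weight (b : nat) (V : finType) (W : pred {set V}) (D C F : {set V}) : nat :=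
  if forces_on b W D C F then b.+1 ^ #|C :&: D| else 0.

Definition total_weight (b : nat) (V I : finType) (B : I -> {set V})
    (W : I -> pred {set V}) (C F : {set V}) : nat :=
  \sum_i board_weight b (W i) (B i) C F.

Lemma board_family_reindex (b v : nat) (V I J : finType) (h : J -> I) (B : I -> {set V})
    (W : I -> pred {set V}) : injective h ->
  board_family b v B W -> board_family b v (B \o h) (W \o h).
Proof.
move=> injh [disjB famB]; split=> [i j ij|i]; last exact: famB.
by apply: disjB; rewrite (inj_eq injh).
Qed.

Lemma disjoint_setU1D (V : finType) (C F O : {set V}) x :
  [disjoint C & F] -> x \in O -> [disjoint x |: C & F :\: O].
Proof.
move=> dCF xO; rewrite -setI_eq0 setIUl setU_eq0 !setI_eq0 disjoints1 inE xO /=.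
exact: disjointWr (subsetDl _ _) dCF.
Qed.

Lemma card_touched (V I : finType) (B : I -> {set V}) (O : {set V}) :
  (forall i j, i != j -> [disjoint B i & B j]) -> #|touched B O| <= #|O|.
Proof.
move=> disjB; have disjOB i j : i != j -> [disjoint O :&: B i & O :&: B j].
  by move=> /disjB; apply/disjointW; apply: subsetIr.
apply: (@leq_trans #|\bigcup_i (O :&: B i)|); last first.
  by apply/subset_leq_card/bigcupsP => i _; apply: subsetIl.
rewrite -[leqRHS]sum1_card partition_disjoint_bigcup // -sum1_card big_mkcond /=.
by apply: leq_sum => i _; rewrite sum1_card inE; case: ifP; rewrite ?card_gt0.
Qed.

Lemma board_weight_leq (b v : nat) (V : finType) (W : pred {set V}) (D C F : {set V}) :
  #|D| <= v -> board_weight b W D C F <= b.+1 ^ v.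
Proof.
move=> Dv; rewrite /board_weight; case: ifP => // _; apply: leq_pexp2l => //.
exact: leq_trans (subset_leq_card (subsetIr _ _)) Dv.
Qed.

Lemma board_weight_reply (b : nat) (V : finType) (W : pred {set V}) (D C F O : {set V}) :
  [disjoint C & F] -> offer b F O -> O :&: D != set0 ->
  exists2 x, x \in O &
    b.+1 * board_weight b W D C F <= board_weight b W D (x |: C) (F :\: O).
Proof.
move=> dCF offO OD0; rewrite /board_weight.
case: ifP => [win|_]; last by have [x /setIP[xO _]] := set0Pn _ OD0; exists x; rewrite ?muln0.
have [x /setIP[xO xD] win_x] := forces_on_reply win offO OD0; exists x => //.
have xC : x \notin C.
  by rewrite (disjointFl dCF) //; have [/subsetP sOF _] := andP offO; apply: sOF.
by rewrite win_x setU1I_in // cardsU1 inE (negPf xC) expnS.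
Qed.

Section Boards.
Context {b v : nat} {V I : finType} {B : I -> {set V}} {W : I -> pred {set V}}.
Hypothesis family_BW : board_family b v B W.
Implicit Types (C D F O X : {set V}) (x : V).

Local Notation weight C F i := (board_weight b (W i) (B i) C F).

Lemma total_weight_reply C F O x : x \in O ->
  total_weight b B W (x |: C) (F :\: O) + \sum_(i in touched B O) weight C F i =
  total_weight b B W C F + \sum_(i in touched B O) weight (x |: C) (F :\: O) i.
Proof.
move=> xO; rewrite /total_weight !(bigID (mem (touched B O)) xpredT) /=.
suff -> : \sum_(i | i \notin touched B O) weight (x |: C) (F :\: O) i =
          \sum_(i | i \notin touched B O) weight C F i by lia.
apply: eq_bigr => i; rewrite inE negbK => /eqP OB0.
have xB : x \notin B i.
  by apply: contra_eqN OB0 => xB; apply/set0Pn; exists x; rewrite inE xO.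
by rewrite /board_weight forces_on_untouched // setU1I_out.
Qed.

Lemma total_weight_loss D C F O x : offer b F O -> x \in O :&: D ->
  (forall i, [disjoint D & B i]) ->
  total_weight b B W C F <= total_weight b B W (x |: C) (F :\: O) + b * b.+1 ^ v.
Proof.
have [disjB famB] := family_BW.
move=> /andP[_ /andP[_ Ob]] /setIP[xO xD] dDB.
have touchedE : touched B O = touched B (O :\ x).
  apply/setP => i; rewrite !inE; congr (_ != _); apply/setP => y; rewrite !inE.
  by have [->|//] := eqVneq; rewrite (disjointFr (dDB i) xD) !andbF.
have few : #|touched B O| <= b.
  rewrite touchedE; apply: leq_trans (card_touched _ disjB) _.
  by move: Ob; rewrite (cardsD1 x) xO.
have := total_weight_reply C F xO.
suff : \sum_(i in touched B O) weight C F i <= b * b.+1 ^ v by lia.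
apply: (@leq_trans (#|touched B O| * b.+1 ^ v)); last by rewrite leq_mul2r few orbT.
rewrite -sum_nat_const; apply: leq_sum => i _; have [Bv _ _] := famB i.
exact: board_weight_leq.
Qed.

Lemma total_weight_gain C F O : [disjoint C & F] -> offer b F O ->
  exists2 x, x \in O & total_weight b B W C F <= total_weight b B W (x |: C) (F :\: O).
Proof.
have [disjB _] := family_BW; move=> dCF offO; have [_ /andP[O0 Ob]] := andP offO.
have [touched0|/set0Pn[i0 i0O]] := eqVneq (touched B O) set0.
  have [x xO] := card_gt0P O0; exists x => //.
  by have := total_weight_reply C F xO; rewrite touched0 !big_set0; lia.
have [i iO heaviest] := @arg_maxnP _ i0 (mem (touched B O)) (fun i => weight C F i) i0O.
have OB0 : O :&: B i != set0 by move: iO; rewrite /= inE.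
have [x xO gain] := board_weight_reply (W i) dCF offO OB0; exists x => //.
have before : \sum_(j in touched B O) weight C F j <= b.+1 * weight C F i.
  apply: (@leq_trans (#|touched B O| * weight C F i)).
    by rewrite -sum_nat_const; apply: leq_sum => j /heaviest.
  by rewrite leq_mul2r (leq_trans (card_touched O disjB) Ob) orbT.
have after : weight (x |: C) (F :\: O) i <= \sum_(j in touched B O) weight (x |: C) (F :\: O) j.
  by rewrite (bigD1 i) //= leq_addr.
by have := total_weight_reply C F xO; lia.
Qed.

Lemma total_weight_start X : (forall i, B i \subset X) -> total_weight b B W set0 X = #|I|.
Proof.
move=> sBX; have [_ famB] := family_BW; rewrite -sum1_card; apply: eq_bigr => i _.
have [_ _ win] := famB i.
by rewrite /board_weight forces_on_start // win set0I cards0.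
Qed.

Lemma total_weight_end C : 0 < total_weight b B W C set0 -> exists i, W i C.
Proof.
have [_ famB] := family_BW; rewrite lt0n sum_nat_eq0 negb_forall => /existsP[i].
rewrite /board_weight /forces_on set0I forces_end.
have [_ monoW _] := famB i; case: ifP => // Wi _; exists i.
exact: monoW (subsetIl C (B i)) Wi.
Qed.

(* Client answers in D whenever D is touched, and otherwise in the heaviest touched
   board; only the answers in D decrease the total weight. *)
Lemma forces_add_boards (W0 : pred {set V}) D :
  monotone W0 -> forces b W0 set0 D -> (forall i, [disjoint D & B i]) ->
  b * b.+1 ^ v * #|D| < #|I| ->
  forces b (fun C => W0 C && [exists i, W i C]) set0 (D :|: \bigcup_i B i).
Proof.
move=> monoW0 winD dDB many; pose inv C F := [/\ [disjoint C & F], forces_on b W0 D C F &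
  b * b.+1 ^ v * #|F :&: D| < total_weight b B W C F].
apply: (forces_invariant (I := inv)) => [C|C F O|].
- case=> _; rewrite /forces_on set0I forces_end cards0 muln0.
  move=> /(monoW0 _ _ (subsetIl C D)) -> /total_weight_end[i Wi] /=.
  by apply/existsP; exists i.
- case=> dCF win heavy offO; have [OD0|OD0] := eqVneq (O :&: D) set0.
    have [x xO gain] := total_weight_gain dCF offO; exists x => //.
    split; [exact: disjoint_setU1D|by rewrite forces_on_untouched|].
    by rewrite setDI_distrl OD0 setD0; apply: leq_trans gain.
  have [x xOD win_x] := forces_on_reply win offO OD0; have /setIP[xO _] := xOD.
  exists x => //; split; [exact: disjoint_setU1D|exact: win_x|].
  have ltD : #|(F :\: O) :&: D| < #|F :&: D|.
    by rewrite setDI_distrl; apply: ltn_card_offer (offerI offO OD0).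
  have loss := total_weight_loss C offO xOD dDB.
  have : b * b.+1 ^ v * #|(F :\: O) :&: D|.+1 <= b * b.+1 ^ v * #|F :&: D|.
    by rewrite leq_mul2l ltD orbT.
  rewrite mulnS; lia.
split; first by rewrite disjoints_subset sub0set.
  by rewrite forces_on_start ?subsetUl.
rewrite (setIidPr (subsetUl _ _)) total_weight_start // => i.
by apply: subset_trans (subsetUr _ _); apply: bigcup_sup.
Qed.

End Boards.

Lemma card_bigcup_leq (V I : finType) (B : I -> {set V}) v :
  (forall i, #|B i| <= v) -> #|\bigcup_i B i| <= #|I| * v.
Proof.
move=> Bv; rewrite -sum_nat_const.
elim/big_rec2: _ => [|i s X _ le_s]; first by rewrite cards0.
exact: leq_trans (leq_card_setU _ _) (leq_add (Bv i) le_s).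
Qed.

Lemma monotone_and_exists (V I : finType) (W0 : pred {set V}) (W : I -> pred {set V}) :
  monotone W0 -> (forall i, monotone (W i)) ->
  monotone (fun C => W0 C && [exists i, W i C]).
Proof.
move=> monoW0 monoW C C' CC' /andP[/(monoW0 _ _ CC') -> /existsP[i /(monoW _ _ _ CC') Wi]].
by apply/existsP; exists i.
Qed.

(* Each kind needs many more boards than the kinds secured before it have vertices. *)
Lemma forces_each_kind (K : finType) (b v n d : nat) : exists M, forall (V : finType)
    (D : {set V}) (W0 : pred {set V}) (S : {set K}) (B : K * 'I_M -> {set V})
    (W : K * 'I_M -> pred {set V}),
  #|S| = n -> #|D| <= d -> monotone W0 -> forces b W0 set0 D ->
  board_family b v B W -> (forall k i, k \in S -> [disjoint D & B (k, i)]) ->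
  forces b (fun C => W0 C && [forall k in S, exists i, W (k, i) C]) set0 setT.
Proof.
elim: n d => [|n IH] d.
  exists 0 => V D W0 S B W; move/eqP; rewrite cards_eq0 => /eqP-> _ monoW0 winD _ _.
  apply: forces_sub (forces_superset monoW0 (subsetT D) winD) => C ->.
  by apply/forall_inP => k; rewrite inE.
pose M_first := (b * b.+1 ^ v * d).+1; have [M_rest IH_rest] := IH (d + M_first * v).
have [le_first le_rest] := (leq_maxl M_first M_rest, leq_maxr M_first M_rest).
exists (maxn M_first M_rest) => V D W0 S B W Sn Dd monoW0 winD famBW dDB.
have [k kS] : exists k, k \in S by apply/card_gt0P; rewrite Sn.
pose first_board (i : 'I_M_first) := (k, widen_ord le_first i).
have inj_first : injective first_board by move=> i j [/val_inj].
have fam_first := board_family_reindex inj_first famBW; have [disjB famB] := famBW.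
have := forces_add_boards fam_first monoW0 winD (fun i => dDB k _ kS).
rewrite card_ord ltnS leq_mul2l Dd orbT => /(_ isT).
set D' := D :|: _; set W0' := (fun _ => _); move=> winD'.
have card_D' : #|D'| <= d + M_first * v.
  apply: leq_trans (leq_card_setU _ _) (leq_add Dd _).
  have := @card_bigcup_leq _ _ (B \o first_board) v; rewrite card_ord; apply=> i.
  by have [] := famB (first_board i).
have monoW0' : monotone W0'.
  by apply: monotone_and_exists => // i; have [] := famB (first_board i).
pose rest_board (p : K * 'I_M_rest) := (p.1, widen_ord le_rest p.2).
have inj_rest : injective rest_board by move=> [l i] [l' j] [-> /val_inj ->].
apply: forces_sub (IH_rest V D' W0' (S :\ k) _ _ _ card_D' monoW0' winD'
                     (board_family_reindex inj_rest famBW) _) => [C||l i].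
- case/andP=> /andP[-> /existsP[i Wi]] /forall_inP others /=; apply/forall_inP => l lS.
  have [->|lk] := eqVneq l k; first by apply/existsP; exists (widen_ord le_first i).
  have /existsP[j Wj] : [exists j, (W \o rest_board) (l, j) C] by apply: others; rewrite !inE lk.
  by apply/existsP; exists (widen_ord le_rest j).
- by move: Sn; rewrite (cardsD1 k) kS => -[].
rewrite !inE => /andP[lk lS]; rewrite -setI_eq0 setIUl setU_eq0 !setI_eq0 dDB //=.
rewrite disjoint_sym; apply: bigcup_disjoint => j _; apply: disjB.
by apply: contraNneq lk => -[->].
Qed.

(** * Copies and trees *)

Definition is_copy (VH : finType) (eH : rel VH) (A : {set VH}) (VG : finType)
    (eG : rel VG) (C : {set VG}) (f : VH -> VG) : Prop :=
  [/\ {in A, forall x, f x \in C}, {in A &, injective f} &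
      {in A &, forall x y, eH x y -> eG (f x) (f y)}].

Section Copies.
Context {VH : finType} {eH : rel VH}.
Implicit Types (A : {set VH}).

Lemma has_copyP A (VG : finType) (eG : rel VG) (C : {set VG}) :
  reflect (exists f, is_copy eH A eG C f) (has_copy eH A eG C).
Proof.
apply: (iffP existsP) => [[f /andP[/forall_inP fC /forall_inP fA]]|[f [fC injf homf]]].
  exists f; split=> // x y xA yA; have /forall_inP /(_ y yA) /andP[] := fA x xA.
    by move=> /implyP inj _ fxy; apply/eqP/inj; rewrite fxy.
  by move=> _ /implyP.
exists (finfun f); apply/andP; split; first by apply/forall_inP => x /fC; rewrite ffunE.
apply/forall_inP => x xA; apply/forall_inP => y yA; rewrite !ffunE.
apply/andP; split; apply/implyP; last exact: homf.
by move=> /eqP /injf ->.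
Qed.

Lemma has_copy_monotone A (VG : finType) (eG : rel VG) : monotone (has_copy eH A eG).
Proof.
move=> C C' /subsetP sCC' /has_copyP[f [fC injf homf]]; apply/has_copyP; exists f.
by split=> // x /fC /sCC'.
Qed.

Lemma has_copy_subset A A' (VG : finType) (eG : rel VG) (C : {set VG}) :
  A \subset A' -> has_copy eH A' eG C -> has_copy eH A eG C.
Proof.
move=> /subsetP sAA' /has_copyP[f [fC injf homf]]; apply/has_copyP; exists f.
by split=> [x /sAA'/fC //|x y /sAA' xA /sAA' yA|x y /sAA' xA /sAA' yA]; [apply: injf|apply: homf].
Qed.

Lemma has_copy_set1 x (VG : finType) (eG : rel VG) (C : {set VG}) v :
  irreflexive eH -> v \in C -> has_copy eH [set x] eG C.
Proof.
move=> irr vC; apply/has_copyP; exists (fun=> v).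
by split=> // y z; rewrite !inE => /eqP-> /eqP-> //; rewrite irr.
Qed.

Lemma has_copy_imset A (U V : finType) (eU : rel U) (eV : rel V) (f : U -> V) (C : {set U}) :
  injective f -> {homo f : x y / eU x y >-> eV x y} ->
  has_copy eH A eU C -> has_copy eH A eV (f @: C).
Proof.
move=> injf homf /has_copyP[g [gC injg homg]]; apply/has_copyP; exists (f \o g).
split=> [x /gC gx|x y xA yA /injf/injg|x y xA yA exy]; first exact: imset_f.
  exact.
by apply/homf/homg.
Qed.

Lemma has_copy_of_imset A (U V : finType) (eU : rel U) (eV : rel V) (f : U -> V)
    (C : {set U}) (u0 : U) :
  (forall x y, eV (f x) (f y) -> eU x y) ->
  has_copy eH A eV (f @: C) -> has_copy eH A eU C.
Proof.
move=> reflf /has_copyP[h [hC injh homh]].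
have /fin_all_exists[g gE] z : exists u, z \in A -> u \in C /\ f u = h z.
  have [/hC/imsetP[u uC hz]|zA] := boolP (z \in A); last by exists u0.
  by exists u.
apply/has_copyP; exists g; split=> [z zA|z w zA wA gzw|z w zA wA ezw].
- by have [] := gE z zA.
- have [[_ gz] [_ gw]] := (gE z zA, gE w wA).
  by apply: injh; rewrite // -gz -gw gzw.
- have [[_ gz] [_ gw]] := (gE z zA, gE w wA).
  by apply: reflf; rewrite gz gw; apply: homh.
Qed.

End Copies.

Lemma simple_connect_sym (V : finType) (e : rel V) : simple_graph e -> connect_sym e.
Proof. by case=> sym _; apply: sym_connect_sym. Qed.

Lemma connect_crossing (V : finType) (e : rel V) (S : {set V}) y z :
  connect e y z -> y \in S -> z \notin S -> exists a c, [/\ a \in S, c \notin S & e a c].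
Proof.
move=> /connectP[p pp ->]; elim: p y pp => [|c p IH] y /=; first by move=> _ ->.
move=> /andP[eyc pp] yS; have [cS|cS] := boolP (c \in S); first exact: IH.
by move=> _; exists y, c.
Qed.

Section Components.
Context {VH : finType} {eH : rel VH}.
Hypothesis symH : connect_sym eH.

Lemma mem_component x : x \in component eH x.
Proof. by rewrite inE connect0. Qed.

Lemma component_step x y z : y \in component eH x -> eH y z -> z \in component eH x.
Proof. by rewrite !inE => xy /connect1; apply: connect_trans. Qed.

Lemma component_root x : component eH x = fingraph.root eH @^-1: [set fingraph.root eH x].
Proof. by apply/setP => y; rewrite !inE eq_sym root_connect. Qed.

Lemma has_copy_components (V : finType) (e : rel V) (D : VH -> {set V}) (C : {set V}) :
  (forall x y, x != y -> [disjoint D x & D y]) ->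
  (forall x, has_copy eH (component eH x) e (C :&: D x)) -> has_copy eH setT e C.
Proof.
move=> disjD copies; pose r := fingraph.root eH.
have /fin_all_exists[g gP] x : exists g, is_copy eH (component eH x) e (C :&: D x) g.
  exact/has_copyP.
have rP z : z \in component eH (r z) by rewrite inE symH connect_root.
have gCD z : g (r z) z \in C :&: D (r z) by have [gC _ _] := gP (r z); apply: gC.
apply/has_copyP; exists (fun z => g (r z) z); split=> [z _|z w _ _ /= E|z w _ _ ezw].
- by have /setIP[] := gCD z.
- have rzw : r z = r w.
    apply/eqP/negPn/negP => /disjD disj; have [_ zD] := setIP (gCD z).
    by have [_] := setIP (gCD w); rewrite -E (disjointFr disj zD).
  have [_ injg _] := gP (r w); apply: injg => //; last by rewrite -E rzw.
  by rewrite -rzw.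
have rzw : r z = r w by apply/eqP; rewrite root_connect // connect1.
by have [_ _ homg] := gP (r w); rewrite rzw; apply: homg; rewrite // -rzw.
Qed.

Lemma has_copy_component_class x (V : finType) (e : rel V) (C : {set V}) : connect_sym e ->
  has_copy eH (component eH x) e C ->
  exists k, has_copy eH (component eH x) e (C :&: fingraph.root e @^-1: [set k]).
Proof.
move=> symV /has_copyP[f [fC injf homf]]; exists (fingraph.root e (f x)).
apply/has_copyP; exists f; split=> // z zx; rewrite inE fC //= !inE.
rewrite root_connect // symV; apply/negPn/negP => nc.
pose S := [set w in component eH x | connect e (f x) (f w)].
have xz : connect eH x z by move: zx; rewrite inE.
have [||y [w [/setIdP[yx fxy] wS eyw]]] := connect_crossing (S := S) xz.
- by rewrite !inE !connect0.
- by rewrite inE (negPf nc) andbF.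
have wx := component_step yx eyw.
case/negP: wS; rewrite inE wx; apply: connect_trans fxy (connect1 _).
exact: homf.
Qed.

End Components.

Inductive grown (V : finType) (e : rel V) : {set V} -> Prop :=
| grown1 x : grown e [set x]
| grownU1 S x y of grown e S & x \notin S & y \in S & e x y : grown e (x |: S).

Definition arcs (V : finType) (e : rel V) (S : {set V}) : {set V * V} :=
  [set p | [&& p.1 \in S, p.2 \in S & e p.1 p.2]].

(* Every edge gives two arcs, so that s vertices span at most s - 1 edges. *)
Definition sparse (V : finType) (e : rel V) : Prop :=
  forall S : {set V}, S != set0 -> #|arcs e S| + 2 <= 2 * #|S|.

Definition induced (V : finType) (e : rel V) (D : {set V}) : rel {x | x \in D} :=
  fun x y => e (val x) (val y).
Arguments induced {V} e D.

Section Grown.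
Context {V : finType} {e : rel V}.
Implicit Types (S : {set V}) (x y z : V).

Lemma grown_inhabited S : grown e S -> exists x, x \in S.
Proof. by case=> [x|S' x y _ _ _ _]; exists x; rewrite !inE eqxx. Qed.

Lemma grown_connected S : simple_graph e -> grown e S ->
  {in S &, forall x y, connect [rel x y in S | e x y] x y}.
Proof.
move=> [sym _]; have symS S' : connect_sym [rel x y in S' | e x y].
  by apply: sym_connect_sym => x y; rewrite /= sym [(x \in S') && _]andbC.
elim=> [x y z|S' x y _ IH xS yS exy]; first by rewrite !inE => /eqP-> /eqP->; apply: connect0.
have sub : subrel (connect [rel x y in S' | e x y]) (connect [rel x' y in x |: S' | e x' y]).
  apply: connect_sub => u w /= /andP[/andP[uS wS] euw]; apply: connect1.
  by rewrite /= !inE uS wS euw !orbT.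
have from_x z : z \in S' -> connect [rel x' y in x |: S' | e x' y] x z.
  move=> zS; apply: connect_trans (sub _ _ (IH y z yS zS)).
  by apply: connect1; rewrite /= !inE eqxx yS exy orbT.
move=> z w; rewrite !inE => /orP[/eqP->|zS] /orP[/eqP->|wS].
- exact: connect0.
- exact: from_x.
- by rewrite symS; apply: from_x.
- exact/sub/IH.
Qed.

(* A second neighbour z would close a cycle through x and a path inside S. *)
Lemma forest_grown_nbr S x y z : is_forest e -> grown e S -> x \notin S ->
  y \in S -> z \in S -> e x y -> e x z -> y = z.
Proof.
move=> [simple_e acyclic_e] growS xS yS zS exy exz; apply/eqP/negPn/negP => yz.
have /connectP[p0 p0P p0z] := grown_connected simple_e growS yS zS.
case/shortenP: p0P p0z => p pP uniq_p _ pz.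
have pathS : path e y p /\ {subset p <= S}.
  elim: p y pP {uniq_p pz yS exy yz} => //= w p IH y /andP[/andP[/andP[_ wS] ->]].
  by case/IH=> -> sub; split=> // u; rewrite inE => /orP[/eqP->|/sub].
have [path_p sub_p] := pathS; apply: acyclic_e; exists (x :: y :: p); split.
- rewrite cons_uniq uniq_p andbT; apply: contraNN xS; rewrite inE => /orP[/eqP->//|].
  exact: sub_p.
- by case: p {pP uniq_p pathS path_p sub_p} pz => //= zy; rewrite zy eqxx in yz.
by have [sym _] := simple_e; rewrite /= exy rcons_path path_p -pz /= sym.
Qed.

Lemma exists_grown_subset x k : simple_graph e -> 0 < k <= #|component e x| ->
  exists S, [/\ grown e S, S \subset component e x & #|S| = k].
Proof.
move=> simple_e; have symc := simple_connect_sym simple_e; have [sym _] := simple_e.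
elim: k => // -[_ _|k IH].
  by exists [set x]; rewrite cards1 sub1set mem_component; split=> //; apply: grown1.
move=> /= lt_k; have [|S [growS sS cardS]] := IH; first by rewrite /= ltnW.
have [z zx zS] : exists2 z, z \in component e x & z \notin S.
  by apply/subsetPn; apply: contraTN lt_k => /subset_leq_card; rewrite cardS -ltnNge.
have [y yS] := grown_inhabited growS.
have yz : connect e y z.
  move: (subsetP sS y yS) zx; rewrite !inE symc; exact: connect_trans.
have [a [c [aS cS eac]]] := connect_crossing yz yS zS.
exists (c |: S); split; last by rewrite cardsU1 cS cardS.
  by apply: grownU1 growS cS aS _; rewrite sym.
by rewrite subUset sub1set sS (component_step (subsetP sS a aS) eac).
Qed.

Lemma grown_component x : simple_graph e -> grown e (component e x).
Proof.
move=> simple_e; have [|S [growS sS cardS]] := @exists_grown_subset x #|component e x| simple_e.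
  by rewrite leqnn andbT; apply/card_gt0P; exists x; apply: mem_component.
by have /eqP <- : S == component e x by rewrite eqEcard sS cardS leqnn.
Qed.

Lemma tree_component x : is_tree e -> component e x = setT.
Proof. by move=> [_ [_ conn]]; apply/setP => y; rewrite !inE conn. Qed.

Lemma grown_tree : is_tree e -> grown e setT.
Proof.
move=> tree_e; have [[simple_e _] [/card_gt0P[x _] _]] := tree_e.
by rewrite -(tree_component x tree_e); apply: grown_component.
Qed.

Lemma card_arcs S : #|arcs e S| = \sum_(x in S) \sum_(y in S) e x y.
Proof.
rewrite -sum1_card big_mkcond pair_big_dep /= [RHS]big_mkcond /=.
by apply: eq_bigr => p _; rewrite inE; case: (_ \in S); case: (_ \in S); case: (e _ _).
Qed.

Lemma arcs0 : arcs e set0 = set0.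
Proof. by apply/setP => p; rewrite !inE. Qed.

Lemma card_arcsU1 S x : simple_graph e -> x \notin S ->
  #|arcs e (x |: S)| = #|arcs e S| + 2 * \sum_(y in S) e x y.
Proof.
move=> [sym irr] xS; rewrite !card_arcs big_setU1 //= big_setU1 //= irr add0n.
have -> : \sum_(a in S) \sum_(y in x |: S) e a y = \sum_(a in S) (e x a + \sum_(y in S) e a y).
  by apply: eq_bigr => a _; rewrite big_setU1 //= sym.
by rewrite big_split /=; lia.
Qed.

Lemma grown_card_arcs S : simple_graph e -> grown e S -> 2 * #|S| <= #|arcs e S| + 2.
Proof.
move=> simple_e; elim=> [x|S' x y _ IH xS yS exy]; first by rewrite cards1 leq_addl.
have deg_x : 0 < \sum_(z in S') e x z by rewrite (bigD1 y) //= exy.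
by rewrite card_arcsU1 // cardsU1 xS; lia.
Qed.

Lemma forest_grown_degree S S' x : is_forest e -> grown e S -> x \notin S ->
  S' \subset S -> \sum_(y in S') e x y <= 1.
Proof.
move=> forest_e growS xS /subsetP sub.
case: (pickP [pred y in S' | e x y]) => [y /andP[/= yS' exy]|none]; last first.
  by rewrite big1 // => y yS'; have := none y; rewrite /= yS' /= => ->.
rewrite (bigD1 y) //= exy big1 // => z /andP[zS' zy]; apply/eqP; rewrite eqb0.
apply: contraNN zy => exz; apply/eqP.
exact: (forest_grown_nbr forest_e growS xS (sub _ zS') (sub _ yS') exz exy).
Qed.

Lemma forest_grown_card_arcs S S' : is_forest e -> grown e S ->
  S' \subset S -> S' != set0 -> #|arcs e S'| + 2 <= 2 * #|S'|.
Proof.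
move=> forest_e growS; have [simple_e _] := forest_e.
have card_arcs1 x : #|arcs e [set x]| = 0.
  by have [_ irr] := simple_e; rewrite !card_arcs !big_set1 irr.
elim: growS S' => [x|S0 x y growS IH xS yS exy] S'.
  by rewrite subset1 => /orP[/eqP->|->//]; rewrite card_arcs1 cards1.
have [xS'|xS'] := boolP (x \in S'); last first.
  move=> sub S'0; apply: IH => //; apply/subsetP => z zS'.
  by have := subsetP sub z zS'; rewrite !inE => /orP[/eqP zx|//]; rewrite -zx zS' in xS'.
rewrite -subDset => sub _.
have xS'' : x \notin S' :\ x by rewrite !inE eqxx.
rewrite -(setD1K xS') card_arcsU1 // cardsU1 xS''.
have [->|S''0] := eqVneq (S' :\ x) set0; first by rewrite arcs0 big_set0 !cards0.
by have := forest_grown_degree forest_e growS xS sub; have := IH _ sub S''0; lia.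
Qed.

Lemma tree_sparse : is_tree e -> sparse e.
Proof.
move=> tree_e S S0; have [forest_e _] := tree_e.
exact: forest_grown_card_arcs forest_e (grown_tree tree_e) (subsetT S) S0.
Qed.

Lemma nedges_arcs : nedges e = #|arcs e setT| %/ 2.
Proof. by congr (#|pred_of_set _| %/ 2); apply/setP => p; rewrite !inE. Qed.

Lemma nedges_tree : is_tree e -> (nedges e).+1 = #|V|.
Proof.
move=> tree_e; have [[simple_e _] [V_gt0 _]] := tree_e.
have lo := grown_card_arcs simple_e (grown_tree tree_e).
have hi : #|arcs e setT| + 2 <= 2 * #|[set: V]|.
  by apply: tree_sparse; rewrite // -cards_eq0 cardsT -lt0n.
by rewrite nedges_arcs; rewrite cardsT in lo hi; lia.
Qed.

End Grown.

Lemma cycle_nbrs (V : eqType) (e : rel V) (s : seq V) x :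
  cycle e s -> uniq s -> 3 <= size s -> x \in s ->
  exists y z, [/\ y \in s, z \in s, y != z, e x y & e z x].
Proof.
move=> cs us ss /rot_to[i s' rot_s].
have mem_s y : (y \in s) = (y \in x :: s') by rewrite -rot_s mem_rot.
move: cs us ss; rewrite -(rot_cycle i) -(rot_uniq i) -(size_rot i) rot_s.
case: s' rot_s mem_s => [|y [|c t]] // rot_s mem_s.
rewrite /= rcons_path => /and3P[exy _ /andP[_ ezx]] /and4P[_ y_ct _ _] _.
exists y, (last c t); split=> //.
- by rewrite mem_s !inE eqxx orbT.
- by rewrite mem_s inE [_ \in y :: _]inE mem_last !orbT.
- by apply: contraNneq y_ct => ->; apply: mem_last.
Qed.

Lemma cycle_card_arcs (V : finType) (e : rel V) (s : seq V) : simple_graph e ->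
  cycle e s -> uniq s -> 3 <= size s -> 2 * #|[set x in s]| <= #|arcs e [set x in s]|.
Proof.
move=> [sym _] cs us ss; rewrite card_arcs mulnC -sum_nat_const.
apply: leq_sum => x; rewrite inE => xs.
have [y [z [ys zs yz exy ezx]]] := cycle_nbrs cs us ss xs.
by rewrite (bigD1 y) ?inE //= (bigD1 z) ?inE ?zs 1?eq_sym //= exy sym ezx.
Qed.

Section Induced.
Context {V : finType} {e : rel V} {D : {set V}}.
Hypothesis simple_e : simple_graph e.

Lemma induced_simple : simple_graph (induced e D).
Proof. by have [sym irr] := simple_e; split=> *; [apply: sym|apply: irr]. Qed.

Lemma induced_acyclic :
  (forall S : {set V}, S \subset D -> S != set0 -> #|arcs e S| < 2 * #|S|) ->
  ~ has_cycle (induced e D).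
Proof.
move=> light [s [us ss cs]].
have heavy : 2 * #|[set x in map val s]| <= #|arcs e [set x in map val s]|.
  apply: cycle_card_arcs; rewrite ?cycle_map ?size_map //.
  by rewrite map_inj_uniq //; apply: val_inj.
move: heavy; apply/negP; rewrite -ltnNge; apply: light.
  by apply/subsetP => x; rewrite inE => /mapP[u _ ->]; apply: valP.
case: s ss {us cs} => // u s _; apply/set0Pn; exists (val u).
by rewrite inE mem_head.
Qed.

Lemma connect_induced (x y : {x | x \in D}) : (forall u w, u \in D -> e u w -> w \in D) ->
  connect e (val x) (val y) -> connect (induced e D) x y.
Proof.
move=> closedD /connectP[p]; elim: p x => [|w p IH] x /=.
  by move=> _ /val_inj->; apply: connect0.
case/andP=> exw path_p last_p; have wD := closedD _ _ (valP x) exw.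
apply: (@connect_trans _ _ (exist _ w wD)); first exact: connect1.
exact: IH.
Qed.

End Induced.

Lemma induced_component_tree (V : finType) (e : rel V) y : simple_graph e ->
  (forall S : {set V}, S \subset component e y -> S != set0 -> #|arcs e S| < 2 * #|S|) ->
  is_tree (induced e (component e y)).
Proof.
move=> simple_e light; have symc := simple_connect_sym simple_e.
split; first by split; [apply: induced_simple|apply: induced_acyclic].
split; first by rewrite card_sig; apply/card_gt0P; exists y; apply: mem_component.
move=> x z; apply: connect_induced => [u w|]; first exact: component_step.
by move: (valP x) (valP z); rewrite !inE symc; apply: connect_trans.
Qed.

Lemma client_wins_induced (b : nat) (VH : finType) (eH : rel VH) (A : {set VH})
    (V : finType) (e : rel V) (D : {set V}) : D != set0 ->
  forces b (has_copy eH A e) set0 D -> client_wins b eH A (induced e D).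
Proof.
case/set0Pn=> x xD; have im_val : val @: [set: {x | x \in D}] = D.
  apply/setP => y; apply/imsetP/idP => [[u _ ->]|yD]; first exact: valP.
  by exists (exist _ y yD).
rewrite client_winsE -{1}im_val -(imset0 (val : {x | x \in D} -> V)).
rewrite forces_imset; last exact: val_inj.
by apply: forces_sub => C; apply: has_copy_of_imset (exist _ x xD) _.
Qed.

Definition winning_tree (b : nat) (VH : finType) (eH : rel VH) (A : {set VH})
    (VT : finType) (eT : rel VT) : Prop :=
  is_tree eT /\ client_wins b eH A eT.

Definition winning_trees_geq (b : nat) (VH : finType) (eH : rel VH) (A : {set VH})
    (v : nat) : Prop :=
  forall (VT : finType) (eT : rel VT), winning_tree b eH A eT -> v <= #|VT|.

Definition add_leaves (V : finType) (e : rel V) (M : nat) : rel (V + V * 'I_M) :=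
  fun u w => match u, w with
             | inl x, inl y => e x y
             | inl x, inr l => x == l.1
             | inr l, inl x => x == l.1
             | inr _, inr _ => false
             end.
Arguments add_leaves {V} e M.

Section AddLeaves.
Context {V : finType} {e : rel V} {M : nat}.
Hypothesis tree_e : is_tree e.

Lemma add_leaves_simple : simple_graph (add_leaves e M).
Proof.
have [[[sym irr] _] _] := tree_e.
by split=> [[x|l] [y|k]|[x|l]] //=.
Qed.

(* A new leaf has a single neighbour, so that no cycle goes through it. *)
Lemma add_leaves_acyclic : ~ has_cycle (add_leaves e M).
Proof.
case=> s [us ss cs]; have [[_ acyclic_e] _] := tree_e; apply: acyclic_e.
have old u : u \in s -> u \in map inl (enum V).
  case: u => [x|l] ls; first by rewrite map_f ?mem_enum.
  have [[y|y] [[z|z] [_ _ yz]]] := cycle_nbrs cs us ss ls => //=.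
  by move=> /eqP Ey /eqP Ez; rewrite Ey Ez eqxx in yz.
have /subset_mapP[s' _ def_s] := old.
exists s'; move: us ss cs; rewrite def_s size_map map_inj_uniq; last by move=> ? ? [].
by rewrite cycle_map; split.
Qed.

Lemma connect_add_leaves u w : connect (add_leaves e M) u w.
Proof.
have [_ [_ conn_e]] := tree_e; have symc := simple_connect_sym add_leaves_simple.
have conn_inl x y : connect (add_leaves e M) (inl x) (inl y).
  have /connectP[p path_p ->] := conn_e x y.
  by apply/connectP; exists (map inl p); rewrite ?path_map ?last_map.
have to_inl u' : exists x, connect (add_leaves e M) u' (inl x).
  case: u' => [x|l]; first by exists x; apply: connect0.
  by exists l.1; apply: connect1 => /=.
have [[x ux] [y wy]] := (to_inl u, to_inl w).
by apply: connect_trans ux (connect_trans (conn_inl x y) _); rewrite symc.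
Qed.

Lemma add_leaves_tree : is_tree (add_leaves e M).
Proof.
have [_ [V_gt0 _]] := tree_e.
split; first by split; [apply: add_leaves_simple|apply: add_leaves_acyclic].
by split; [rewrite card_sum ltn_addr|apply: connect_add_leaves].
Qed.

End AddLeaves.

Section ExtendCopy.
Context {VH : finType} {eH : rel VH} {S : {set VH}} {x y : VH}.
Hypotheses (forest_H : is_forest eH) (grown_S : grown eH S).
Hypotheses (xS : x \notin S) (yS : y \in S) (exy : eH x y).

Lemma is_copy_add_leaf (V : finType) (e : rel V) (C : {set V}) (f : VH -> V) w :
  simple_graph e -> is_copy eH S e C f -> w \in C -> {in S, forall z, f z != w} ->
  e (f y) w -> is_copy eH (x |: S) e C (fun z => if z == x then w else f z).
Proof.
move=> [sym _] [fC injf homf] wC fresh ew; have [[symH irrH] _] := forest_H.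
have old z : z \in S -> (z == x) = false by move=> zS; apply: contraNF xS => /eqP <-.
have nbr z : z \in S -> eH x z -> z = y.
  by move=> zS exz; apply: (forest_grown_nbr forest_H grown_S xS zS yS exz exy).
split=> [z|z z'|z z']; rewrite !inE.
- by case/orP=> [/eqP->|zS]; rewrite ?eqxx // old // fC.
- case/orP=> [/eqP->|zS] /orP[/eqP->|z'S]; rewrite ?eqxx ?old //.
  + by move/esym/eqP; rewrite (negPf (fresh _ z'S)).
  + by move/eqP; rewrite (negPf (fresh _ zS)).
  + exact: injf.
- case/orP=> [/eqP->|zS] /orP[/eqP->|z'S]; rewrite ?eqxx ?old ?irrH //.
  + by move/(nbr _ z'S)->; rewrite sym.
  + by rewrite symH => /(nbr _ zS)->.
  + exact: homf.
Qed.

Lemma has_copy_add_leaves (V : finType) (e : rel V) M (C : {set V + V * 'I_M}) :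
  is_tree e -> has_copy eH S (add_leaves e M) (C :&: inl @: [set: V]) ->
  (forall a, exists i, inr (a, i) \in C) -> has_copy eH (x |: S) (add_leaves e M) C.
Proof.
move=> tree_e /has_copyP[f [fC injf homf]] leaves.
have [_ /imsetP[a _ fya]] := setIP (fC y yS); have [i iC] := leaves a.
apply/has_copyP; exists (fun z => if z == x then inr (a, i) else f z).
apply: is_copy_add_leaf => //; first exact: add_leaves_simple.
- by split=> // z /fC/setIP[].
- by move=> z /fC/setIP[_ /imsetP[c _ ->]].
- by rewrite fya /=.
Qed.

End ExtendCopy.

Lemma winning_tree_unit (b : nat) (VH : finType) (eH : rel VH) x : irreflexive eH ->
  winning_tree b eH [set x] [rel _ _ : unit | false].
Proof.
move=> irrH; split.
  split; first by split=> // -[[|u [|w s]] []].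
  by split=> [|[] []]; [rewrite card_unit|apply: connect0].
rewrite client_winsE; have -> : [set: unit] = [set tt] by apply/setP => -[]; rewrite !inE.
by apply: forces_sub (forces_set1 tt) => C; apply: has_copy_set1.
Qed.

Section GrowWinningTree.
Context {b : nat} {VH : finType} {eH : rel VH}.
Hypothesis forest_H : is_forest eH.

Lemma board_family_leaves (V : finType) (M : nat) :
  board_family b 1 (fun l : V * 'I_M => [set inr l : V + V * 'I_M])
    (fun l C => inr l \in C).
Proof.
split=> [l k lk|l]; first by rewrite disjoints1 inE; apply: contraNneq lk => -[->].
split; [by rewrite cards1|by move=> C C' /subsetP; apply|exact: forces_set1].
Qed.

Lemma winning_tree_add_leaf S x y (VT : finType) (eT : rel VT) :
  grown eH S -> x \notin S -> y \in S -> eH x y -> winning_tree b eH S eT ->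
  exists M, winning_tree b eH (x |: S) (add_leaves eT M).
Proof.
move=> growS xS yS exy [tree_T win_T].
have [M enough_M] := forces_each_kind VT b 1 #|VT| #|VT|.
exists M; split; first exact: add_leaves_tree.
pose D : {set VT + VT * 'I_M} := inl @: [set: VT].
pose copy_in_D := fun C => has_copy eH S (add_leaves eT M) (C :&: D).
have mono_copy : monotone copy_in_D.
  by move=> C C' CC'; apply: has_copy_monotone; apply: setSI.
have inl_inj : injective (@inl VT (VT * 'I_M)) by move=> ? ? [].
have win_D : forces b copy_in_D set0 D.
  rewrite client_winsE in win_T; rewrite -(imset0 inl) /D forces_imset //.
  apply: forces_sub win_T => C copyC; rewrite /copy_in_D (setIidPl (imsetS _ (subsetT C))).
  exact: has_copy_imset inl_inj _ copyC.
rewrite client_winsE; apply: forces_sub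
  (enough_M _ D copy_in_D setT _ _ (cardsT _) _ mono_copy win_D (board_family_leaves VT M) _).
- move=> C /andP[copyC /forall_inP leaves].
  apply: (has_copy_add_leaves forest_H growS xS yS exy tree_T copyC) => a.
  by apply/existsP; apply: leaves; rewrite inE.
- by rewrite card_imset // cardsT.
- by move=> a i _; rewrite disjoint_sym disjoints1; apply/imsetP => -[].
Qed.

Lemma exists_winning_tree (A : {set VH}) : grown eH A ->
  exists (VT : finType) (eT : rel VT), winning_tree b eH A eT.
Proof.
have [[_ irrH] _] := forest_H.
elim=> [x|S x y growS [VT [eT winT]] xS yS exy].
  by exists unit, [rel _ _ | false]; apply: winning_tree_unit.
have [M winM] := winning_tree_add_leaf growS xS yS exy winT.
by exists (VT + VT * 'I_M)%type, (add_leaves eT M).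
Qed.

End GrowWinningTree.

Lemma winning_tree_leq (b : nat) (VH : finType) (eH : rel VH) x v : is_forest eH ->
  (forall (VT : finType) (eT : rel VT),
     min_winning_tree b eH (component eH x) eT -> #|VT| <= v) ->
  exists (VT : finType) (eT : rel VT),
    winning_tree b eH (component eH x) eT /\ #|VT| <= v.
Proof.
move=> forest_H min_leq; have [simple_H _] := forest_H.
have [VT [eT winT]] := @exists_winning_tree b _ _ forest_H _ (grown_component x simple_H).
have [n] := ubnP #|VT|; elim: n VT eT winT => // n IH VT eT winT lt_n.
have [[VT' [eT' [winT' lt_T]]]|minT] := classic (exists (VT' : finType) (eT' : rel VT'),
  winning_tree b eH (component eH x) eT' /\ #|VT'| < #|VT|).
  by apply: IH winT' _; apply: leq_trans lt_T _.
exists VT, eT; split=> //; apply: (min_leq _ eT); have [treeT clientT] := winT.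
split=> // VT' eT' treeT' clientT'; rewrite leqNgt; apply/negP => lt_T.
by apply: minT; exists VT', eT'.
Qed.

Lemma winning_host_gt1 (b : nat) (VH : finType) (eH : rel VH) x y
    (V : finType) (e : rel V) :
  simple_graph eH -> eH x y -> client_wins b eH (component eH x) e -> 1 < #|V|.
Proof.
move=> [_ irr] exy; rewrite client_winsE => /forces_attainable[C /has_copyP[f [_ injf _]]].
have xy : x != y by apply: contraTneq exy => ->; rewrite irr.
have fxy : f x != f y.
  by apply: contraNneq xy => /injf->; rewrite ?mem_component // inE connect1.
by apply: leq_trans (max_card (mem [set f x; f y])); rewrite cards2 fxy.
Qed.

(** * Sparse hosts and disjoint boards *)

Definition has_dense_set (V : finType) (e : rel V) (w q : nat) : bool :=
  [exists S : {set V}, (#|S| == w) && (2 * q <= #|arcs e S|)].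

Lemma has_dense_setPn (V : finType) (e : rel V) (w q : nat) :
  reflect (forall S : {set V}, #|S| = w -> #|arcs e S| < 2 * q) (~~ has_dense_set e w q).
Proof.
rewrite negb_exists; apply: (iffP forallP) => [light S /eqP Sw|light S].
  by have := light S; rewrite Sw ltnNge.
by rewrite negb_and -implybE -ltnNge; apply/implyP => /eqP; apply: light.
Qed.

Section WaiterWinsSparse.
Context {V : finType} {e : rel V}.
Hypothesis simple_e : simple_graph e.

Lemma component_ltn_card v y : 0 < v -> ~~ has_dense_set e v v.-1 -> #|component e y| < v.
Proof.
move=> v_gt0 /has_dense_setPn light; rewrite ltnNge; apply/negP => le_v.
have [|S [growS _ cardS]] := @exists_grown_subset V e y v simple_e; first by rewrite v_gt0.
by have := light S cardS; have := grown_card_arcs simple_e growS; lia.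
Qed.

(* Otherwise every component of the host is a tree with fewer than v vertices. *)
Lemma client_wins_has_dense_set (b : nat) (VH : finType) (eH : rel VH) x v : 0 < v ->
  winning_trees_geq b eH (component eH x) v -> client_wins b eH setT e ->
  exists i : 'I_v, has_dense_set e i.+1 (minn i.+1 v.-1).
Proof.
move=> v_gt0 min_v win; apply/existsP; apply: contraTT win => /existsPn no_dense.
have light w q : 0 < w <= v -> minn w v.-1 = q -> ~~ has_dense_set e w q.
  case: w => // w /= le_v <-; exact: (no_dense (Ordinal le_v)).
have symc := simple_connect_sym simple_e; rewrite client_winsE; apply/negP.
move=> /(forces_sub (fun C => has_copy_subset (subsetT (component eH x)))).
move=> /(forces_class (fun C => has_copy_component_class symc))[k].
rewrite forces_on_start ?subsetT //.
have [->|/set0Pn[y]] := eqVneq (fingraph.root e @^-1: [set k]) set0.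
  rewrite forces_end => /has_copyP[f [fC _ _]].
  by have := fC x (mem_component x); rewrite inE.
rewrite !inE => /eqP <-; rewrite -component_root //.
have lt_v : #|component e y| < v.
  by apply: component_ltn_card => //; apply: light; lia.
have D_neq0 : component e y != set0 by apply/set0Pn; exists y; apply: mem_component.
move/(client_wins_induced D_neq0) => win_D.
suff tree_D : is_tree (induced e (component e y)).
  by have := min_v _ _ (conj tree_D win_D); rewrite card_sig leqNgt lt_v.
apply: induced_component_tree => // S sub S_neq0.
have S_leq := subset_leq_card sub; rewrite -card_gt0 in S_neq0.
by apply: (has_dense_setPn _ #|S| _ _) => //; apply: light; lia.
Qed.

End WaiterWinsSparse.

Definition image_rel (U V : finType) (h : U -> V) (e : rel U) : rel V :=
  fun i j => [exists x, exists y, [&& h x == i, h y == j & e x y]].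

Section ImageRel.
Context {U V : finType} {h : U -> V} {e : rel U}.
Hypothesis injh : injective h.

Lemma image_relE x y : image_rel h e (h x) (h y) = e x y.
Proof.
apply/existsP/idP => [[x' /existsP[y' /and3P[/eqP/injh-> /eqP/injh-> //]]]|exy].
by exists x; apply/existsP; exists y; rewrite !eqxx.
Qed.

Lemma image_relP i j : reflect (exists x y, [/\ i = h x, j = h y & e x y]) (image_rel h e i j).
Proof.
apply: (iffP existsP) => [[x /existsP[y /and3P[/eqP<- /eqP<- exy]]]|[x [y [-> -> exy]]]].
  by exists x, y.
by exists x; apply/existsP; exists y; rewrite !eqxx.
Qed.

Lemma image_rel_simple : simple_graph e -> simple_graph (image_rel h e).
Proof.
move=> [sym irr]; split=> [i j|i].
  by apply/image_relP/image_relP => -[x [y [-> -> exy]]]; exists y, x; rewrite sym.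
by apply/image_relP => -[x [y [-> /injh-> ]]]; rewrite irr.
Qed.

Lemma card_arcs_image_rel (S : {set V}) : #|arcs (image_rel h e) S| = #|arcs e (h @^-1: S)|.
Proof.
pose h2 (p : U * U) := (h p.1, h p.2).
have inj_h2 : injective h2 by move=> [x y] [x' y'] [/injh-> /injh->].
rewrite -(card_imset _ inj_h2); apply: eq_card => -[i j]; rewrite inE /=.
apply/and3P/imsetP => [[iS jS /image_relP[x [y [ix jy exy]]]]|[[x y] + [-> ->]]].
  by exists (x, y); rewrite /h2 -?ix -?jy // !inE /= -ix -jy iS jS.
by rewrite !inE /= image_relE => /and3P[].
Qed.

Lemma image_rel_sparse : sparse e -> sparse (image_rel h e).
Proof.
move=> sparse_e S S_neq0; rewrite card_arcs_image_rel.
have [->|pre_neq0] := eqVneq (h @^-1: S) set0.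
  by rewrite arcs0 cards0; move: S_neq0; rewrite -card_gt0; lia.
apply: leq_trans (sparse_e _ pre_neq0) _; rewrite leq_mul2l /= -(card_imset _ injh).
by apply/subset_leq_card/subsetP => _ /imsetP[x + ->]; rewrite inE.
Qed.

End ImageRel.

Definition winning_sparse_graph (b : nat) (VH : finType) (eH : rel VH) (A : {set VH})
    (U : finType) (e : rel U) : Prop :=
  [/\ simple_graph e, sparse e & client_wins b eH A e].

Lemma winning_tree_pad (b : nat) (VH : finType) (eH : rel VH) (A : {set VH})
    (VT : finType) (eT : rel VT) v : winning_tree b eH A eT -> #|VT| <= v ->
  exists e : rel 'I_v, winning_sparse_graph b eH A e.
Proof.
move=> [tree_T win_T] le_v; have [[simple_T _] _] := tree_T.
pose h (x : VT) : 'I_v := widen_ord le_v (enum_rank x).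
have injh : injective h by move=> x y [/val_inj/enum_rank_inj].
exists (image_rel h eT); split; first exact: image_rel_simple.
  exact: image_rel_sparse injh (tree_sparse tree_T).
rewrite !client_winsE in win_T *; apply: (forces_superset (D := h @: [set: VT])) => //.
  exact: has_copy_monotone.
rewrite -(imset0 h) forces_imset //; apply: forces_sub win_T => C.
by apply: has_copy_imset => // x y; rewrite image_relE.
Qed.

Definition block_rel (K U : finType) (e : K -> rel U) : rel (K * U) :=
  fun p q => (p.1 == q.1) && e p.1 p.2 q.2.

Section BlockRel.
Context {K U : finType} {e : K -> rel U}.

Lemma block_rel_simple : (forall k, simple_graph (e k)) -> simple_graph (block_rel e).
Proof.
move=> simple_e; split=> [[k x] [l y]|[k x]]; rewrite /block_rel /=.
  by rewrite eq_sym; case: eqP => //= ->; have [sym _] := simple_e k; apply: sym.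
by have [_ irr] := simple_e k; rewrite irr andbF.
Qed.

Lemma sum_blocks (S : {set K * U}) (F : K * U -> nat) :
  \sum_(p in S) F p = \sum_k \sum_(x | (k, x) \in S) F (k, x).
Proof. by rewrite pair_big_dep /=; apply: eq_big => [[k x]|[k x] _]. Qed.

Lemma card_arcs_block_rel (S : {set K * U}) :
  #|arcs (block_rel e) S| = \sum_k #|arcs (e k) [set x | (k, x) \in S]|.
Proof.
rewrite card_arcs sum_blocks; apply: eq_bigr => k _; rewrite card_arcs.
apply: eq_big => [x|x _]; first by rewrite inE.
rewrite sum_blocks (bigD1 k) //= [X in _ + X]big1 ?addn0 => [|l lk].
  by apply: eq_big => [y|y _]; rewrite ?inE // /block_rel /= eqxx.
by rewrite big1 // => y _; rewrite /block_rel /= eq_sym (negPf lk).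
Qed.

(* At most (v - 1) / v edges per vertex, where v = #|U|. *)
Lemma block_rel_density (S : {set K * U}) : (forall k, sparse (e k)) ->
  #|U| * #|arcs (block_rel e) S| <= 2 * #|U|.-1 * #|S|.
Proof.
move=> sparse_e; pose X k := [set x | (k, x) \in S].
have -> : #|S| = \sum_k #|X k|.
  rewrite -sum1_card sum_blocks; apply: eq_bigr => k _.
  by rewrite -sum1_card; apply: eq_bigl => x; rewrite inE.
rewrite card_arcs_block_rel !big_distrr /=; apply: leq_sum => k _; rewrite -/(X k).
have [->|X0] := eqVneq (X k) set0; first by rewrite arcs0 !cards0 !muln0.
have := sparse_e k _ X0; have : #|X k| <= #|U| := max_card _.
case: #|U| => [|u]; first by lia.
move: #|arcs _ _| #|X k| => a s le_s le_a.
have : u.+1 * (a + 2) <= u.+1 * (2 * s) by rewrite leq_mul2l le_a orbT.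
by rewrite mulnDr /=; nia.
Qed.

End BlockRel.

Lemma board_family_blocks (b : nat) (VH K U V : finType) (eH : rel VH) (A : K -> {set VH})
    (e : K -> rel U) (eG : rel V) (f : K * U -> V) :
  (forall k, client_wins b eH (A k) (e k)) -> injective f ->
  {homo f : p q / block_rel e p q >-> eG p q} ->
  board_family b #|U| (fun k => [set f (k, u) | u in [set: U]])
    (fun k C => has_copy eH (A k) eG (C :&: [set f (k, u) | u in [set: U]])).
Proof.
move=> win_e injf homf; have inj_block k : injective (fun u => f (k, u)) by move=> u w /injf[].
split=> [k l kl|k].
  rewrite -setI_eq0; apply/eqP/setP => p; rewrite !inE.
  apply/negP => /andP[/imsetP[u _ ->] /imsetP[w _ /injf[/eqP]]].
  by rewrite (negPf kl).
split; first by rewrite card_imset ?cardsT.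
  by move=> C C' CC'; apply: has_copy_monotone; apply: setSI.
rewrite -{1}(imset0 (fun u => f (k, u))) forces_imset //.
have := win_e k; rewrite client_winsE; apply: forces_sub => C copyC.
rewrite (setIidPl (imsetS _ (subsetT C))).
by apply: has_copy_imset copyC => // u w euw; apply: homf; rewrite /block_rel /= eqxx.
Qed.

Lemma client_wins_blocks (b : nat) (VH U : finType) (eH : rel VH) (e : VH -> rel U) :
  simple_graph eH -> (forall x, client_wins b eH (component eH x) (e x)) ->
  exists M : nat, forall (V : finType) (eG : rel V) (f : VH * 'I_M * U -> V),
    injective f -> {homo f : p q / block_rel (fun k : VH * 'I_M => e k.1) p q >-> eG p q} ->
    client_wins b eH setT eG.
Proof.
move=> simple_H win_e; have symH := simple_connect_sym simple_H.
have [M enough_M] := forces_each_kind VH b #|U| #|VH| 0.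
exists M => V eG f injf homf; have famB :=
  board_family_blocks (fun k : VH * 'I_M => win_e k.1) injf homf.
have [disjB _] := famB.
rewrite client_winsE; apply: forces_sub
  (enough_M V set0 predT setT _ _ (cardsT _) _ _ _ famB _) => //=.
- move=> C /forall_inP copies.
  have /fin_all_exists[i iP] x : exists i,
      has_copy eH (component eH x) eG (C :&: [set f (x, i, u) | u in [set: U]]).
    by apply/existsP; apply: copies; rewrite inE.
  apply: (has_copy_components symH (D := fun x => [set f (x, i x, u) | u in [set: U]])) iP.
  move=> x y xy; apply: (disjB (x, i x) (y, i y)).
  by apply: contraNneq xy => -[->].
- by rewrite cards0.
- by rewrite forces_end.
- by move=> x i _; rewrite disjoints_subset sub0set.
Qed.

(** * Random subsets *)

Section RandomSubset.
Local Open Scope ring_scope.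
Import Order.TTheory GRing.Theory Num.Theory.

Definition bernoulli (R : comNzRingType) (T : finType) (p : R) (E : {set T}) : R :=
  p ^+ #|E| * (1 - p) ^+ (#|T| - #|E|).

Definition Pr (R : comNzRingType) (T : finType) (p : R) (Q : pred {set T}) : R :=
  \sum_(E | Q E) bernoulli p E.

Definition Ex (R : comNzRingType) (T : finType) (p : R) (X : {set T} -> R) : R :=
  \sum_E bernoulli p E * X E.

Section Identities.
Context {R : comNzRingType} {T : finType}.
Implicit Types (p : R) (S E : {set T}) (Q : pred {set T}).

Lemma bernoulli_prod p E : bernoulli p E = \prod_t (if t \in E then p else 1 - p).
Proof.
rewrite (bigID (mem E)) /= (eq_bigr (fun=> p)); last by move=> t ->.
rewrite prodr_const; congr (_ * _).
rewrite (eq_bigr (fun=> 1 - p)); last by move=> t /negPf ->.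
rewrite (eq_bigl (mem (~: E))); last by move=> t; rewrite !inE.
by rewrite prodr_const [in RHS]cardsCs setCK.
Qed.

Lemma Pr_superset p S : Pr p (fun E => S \subset E) = p ^+ #|S|.
Proof.
have : \prod_t (p + (if t \in S then 0 else 1 - p)) = \sum_(E in {set T})
    \prod_t (if t \in E then p else if t \in S then 0 else 1 - p).
  exact: bigA_distr.
rewrite (eq_bigr (fun t => if t \in S then p else 1)); last first.
  by move=> t _; case: ifP => _; rewrite ?addr0 // addrC subrK.
rewrite -big_mkcond prodr_const => ->.
rewrite [RHS](bigID (fun E : {set T} => S \subset E)) /=.
rewrite [X in _ = _ + X]big1 ?addr0 => [|E /subsetPn[t tS tE]]; last first.
  by rewrite (bigD1 t) //= (negPf tE) tS mul0r.
apply: eq_big => // E /subsetP SE; rewrite bernoulli_prod; apply: eq_bigr => t _.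
by case: ifP => // tE; case: ifP => // /SE; rewrite tE.
Qed.

Lemma bernoulli_total p : \sum_(E : {set T}) bernoulli p E = 1.
Proof.
rewrite -[RHS](expr0 p) -(cards0 T) -Pr_superset.
by apply: eq_bigl => E; rewrite sub0set.
Qed.

Lemma Pr_predC p Q : Pr p Q = 1 - Pr p (predC Q).
Proof. by rewrite -(bernoulli_total p) (bigID Q) /= addrK. Qed.

Lemma Ex_indicator p Q : Ex p (fun E => (Q E)%:R) = Pr p Q.
Proof.
rewrite /Pr big_mkcond; apply: eq_bigr => E _.
by case: (Q E); rewrite ?mulr1 ?mulr0.
Qed.

Lemma Ex_sum p (I : finType) (X : I -> {set T} -> R) :
  Ex p (fun E => \sum_i X i E) = \sum_i Ex p (X i).
Proof. by rewrite /Ex exchange_big; apply: eq_bigr => E _; rewrite mulr_sumr. Qed.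

Lemma Ex_variance p (X : {set T} -> R) :
  Ex p (fun E => (X E - Ex p X) ^+ 2) = Ex p (fun E => X E ^+ 2) - Ex p X ^+ 2.
Proof.
set mu := Ex p X.
rewrite {1}/Ex (eq_bigr (fun E => bernoulli p E * X E ^+ 2 +
  (- (2 * mu)) * (bernoulli p E * X E) + mu ^+ 2 * bernoulli p E)) => [|E _]; last by ring.
by rewrite !big_split /= -!mulr_sumr bernoulli_total -/(Ex p X) -/mu -/(Ex p _); ring.
Qed.

Lemma Ex_count p (I : finType) (S : I -> {set T}) :
  Ex p (fun E => \sum_i (S i \subset E)%:R) = \sum_i p ^+ #|S i|.
Proof. by rewrite Ex_sum; apply: eq_bigr => i _; rewrite Ex_indicator Pr_superset. Qed.

Lemma Ex_count_sqr p (I : finType) (S : I -> {set T}) :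
  Ex p (fun E => (\sum_i (S i \subset E)%:R) ^+ 2) = \sum_i \sum_j p ^+ #|S i :|: S j|.
Proof.
have -> : Ex p (fun E => (\sum_i (S i \subset E)%:R) ^+ 2) =
    Ex p (fun E => \sum_i \sum_j (S i :|: S j \subset E)%:R).
  apply: eq_bigr => E _; congr (_ * _); rewrite expr2 mulr_suml; apply: eq_bigr => i _.
  by rewrite mulr_sumr; apply: eq_bigr => j _; rewrite subUset -natrM mulnb.
rewrite Ex_sum; apply: eq_bigr => i _; exact: (Ex_count _ (fun j => S i :|: S j)).
Qed.

End Identities.

Section Moments.
Context {R : realDomainType} {T : finType} {p : R}.
Hypothesis p01 : 0 <= p <= 1.
Implicit Types (E : {set T}) (Q : pred {set T}).

Lemma bernoulli_ge0 E : 0 <= bernoulli p E.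
Proof. by have /andP[p0 p1] := p01; rewrite mulr_ge0 ?exprn_ge0 // subr_ge0. Qed.

Lemma Pr_ge0 Q : 0 <= Pr p Q.
Proof. by apply: sumr_ge0 => E _; apply: bernoulli_ge0. Qed.

Lemma ler_Pr Q Q' : (forall E, Q E -> Q' E) -> Pr p Q <= Pr p Q'.
Proof.
move=> sQQ'; rewrite -!Ex_indicator; apply: ler_sum => E _.
apply: ler_wpM2l; first exact: bernoulli_ge0.
by rewrite ler_nat; case QE: (Q E); rewrite // sQQ'.
Qed.

Lemma Pr_union (I : finType) (P : pred I) (Q : pred {set T}) (Q' : I -> pred {set T}) :
  (forall E, Q E -> exists2 i, P i & Q' i E) -> Pr p Q <= \sum_(i | P i) Pr p (Q' i).
Proof.
move=> cover; rewrite big_mkcond /= -Ex_indicator.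
rewrite (eq_bigr (fun i => Ex p (fun E => (P i && Q' i E)%:R))) => [|i _]; last first.
  by rewrite Ex_indicator; case: (P i); rewrite // /Pr big_pred0_eq.
rewrite -Ex_sum; apply: ler_sum => E _; apply: ler_wpM2l; first exact: bernoulli_ge0.
case QE: (Q E); last by apply: sumr_ge0 => i _; apply: ler0n.
have [i Pi Q'i] := cover E QE.
by rewrite (bigD1 i) //= Pi Q'i lerDl; apply: sumr_ge0 => j _; apply: ler0n.
Qed.

Lemma Pr_first_moment (I : finType) (P : pred I) (S : I -> {set T}) Q :
  (forall E, Q E -> exists2 i, P i & S i \subset E) -> Pr p Q <= \sum_(i | P i) p ^+ #|S i|.
Proof.
move=> cover; apply: le_trans (Pr_union (Q' := fun i E => S i \subset E) cover) _.
by apply: ler_sum => i _; rewrite Pr_superset.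
Qed.

Lemma Pr_eq0_chebyshev (X : {set T} -> R) :
  Pr p (fun E => X E == 0) * Ex p X ^+ 2 <= Ex p (fun E => X E ^+ 2) - Ex p X ^+ 2.
Proof.
rewrite -Ex_variance -Ex_indicator /Ex mulr_suml; apply: ler_sum => E _.
rewrite -mulrA; apply: ler_wpM2l; first exact: bernoulli_ge0.
by case: eqP => [->|_]; rewrite ?mul0r ?sqr_ge0 // mul1r sub0r sqrrN.
Qed.

Lemma Pr_second_moment (I : finType) (S : I -> {set T}) :
  Pr p (fun E => [forall i, ~~ (S i \subset E)]) * (\sum_i p ^+ #|S i|) ^+ 2 <=
  \sum_i \sum_j (p ^+ #|S i :|: S j| - p ^+ (#|S i| + #|S j|)).
Proof.
have -> : \sum_i \sum_j (p ^+ #|S i :|: S j| - p ^+ (#|S i| + #|S j|)) =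
    \sum_i \sum_j p ^+ #|S i :|: S j| - (\sum_i p ^+ #|S i|) ^+ 2.
  rewrite expr2 mulr_suml -sumrB; apply: eq_bigr => i _.
  by rewrite mulr_sumr -sumrB; apply: eq_bigr => j _; rewrite exprD.
rewrite -Ex_count_sqr -Ex_count; apply: le_trans (Pr_eq0_chebyshev _).
apply: ler_wpM2r; first exact: sqr_ge0.
by apply: ler_Pr => E /forallP none; rewrite big1 // => i _; rewrite (negPf (none i)).
Qed.

End Moments.

End RandomSubset.

(** * Dense sets and placed copies in the random graph *)

Lemma gadj_simple (n : nat) (E : {set epair n}) : simple_graph (gadj E).
Proof.
split=> [i j|i]; first by apply: eq_existsb => u; rewrite orbC.
apply/existsP => -[u /andP[_]]; rewrite orbb => /andP[/eqP ui /eqP uj].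
by have := valP u; rewrite /= ui uj ltnn.
Qed.

Definition inner_pairs (n : nat) (S : {set 'I_n}) : {set epair n} :=
  [set u | ((val u).1 \in S) && ((val u).2 \in S)].

Lemma card_inner_pairs (n : nat) (S : {set 'I_n}) : #|inner_pairs S| <= #|S| * #|S|.
Proof.
rewrite -cardsX -(card_imset _ val_inj); apply: subset_leq_card.
by apply/subsetP => _ /imsetP[u + ->]; rewrite !inE.
Qed.

Lemma card_arcs_gadj (n : nat) (E : {set epair n}) (S : {set 'I_n}) :
  #|arcs (gadj E) S| <= 2 * #|E :&: inner_pairs S|.
Proof.
pose swap (u : epair n) := ((val u).2, (val u).1).
apply: (@leq_trans #|val @: (E :&: inner_pairs S) :|: swap @: (E :&: inner_pairs S)|).
  apply: subset_leq_card; apply/subsetP => -[i j].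
  rewrite !inE /= => /and3P[iS jS /exists_inP[u uE /orP[]] /andP[/eqP ui /eqP uj]].
    apply/orP; left; apply/imsetP; exists u; first by rewrite !inE uE ui uj iS.
    by rewrite -ui -uj -surjective_pairing.
  by apply/orP; right; apply/imsetP; exists u; rewrite ?inE /swap ?uE ui uj ?jS.
by apply: leq_trans (leq_card_setU _ _) _; rewrite mul2n -addnn leq_add ?leq_imset_card.
Qed.

Lemma exists_subset_card (T : finType) (D : {set T}) q : q <= #|D| ->
  exists2 D' : {set T}, D' \subset D & #|D'| = q.
Proof.
rewrite -bin_gt0 -cards_draws => /card_gt0P[D']; rewrite inE => /andP[sub /eqP cardD'].
by exists D'.
Qed.

Lemma leq_bin_expn n m : 'C(n, m) <= n ^ m.
Proof.
apply: (@leq_trans (n ^_ m)); first by rewrite -bin_ffact leq_pmulr // fact_gt0.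
rewrite -[in leqLHS](card_ord m) -[in leqLHS](card_ord n) -card_inj_ffuns.
by apply: leq_trans (max_card _) _; rewrite card_ffun !card_ord.
Qed.

Definition dense_witnesses (n w q : nat) : {set {set 'I_n} * {set epair n}} :=
  [set i : {set 'I_n} * {set epair n} |
    (#|i.1| == w) && ((i.2 \subset inner_pairs i.1) && (#|i.2| == q))].

Lemma card_dense_witnesses n w q : #|dense_witnesses n w q| <= n ^ w * 2 ^ (w * w).
Proof.
apply: (@leq_trans (\sum_(S : {set 'I_n} | #|S| == w) 2 ^ (w * w))); last first.
  rewrite sum_nat_const leq_mul2r; apply/orP; right.
  apply: leq_trans (leq_bin_expn n w); rewrite -[n in 'C(n, _)]card_ord -card_draws.
  by apply: subset_leq_card; apply/subsetP => S; rewrite inE.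
rewrite -sum1_card (eq_bigl _ _ (in_set _)) -(pair_big_dep
  (fun S : {set 'I_n} => #|S| == w)
  (fun S (D : {set epair n}) => (D \subset inner_pairs S) && (#|D| == q)) (fun _ _ => 1)) /=.
apply: leq_sum => S /eqP Sw; rewrite sum1_card.
apply: (@leq_trans #|powerset (inner_pairs S)|).
  by apply: subset_leq_card; apply/subsetP => D /andP[DS _]; rewrite inE.
by rewrite card_powerset leq_exp2l // -Sw card_inner_pairs.
Qed.

Lemma has_dense_set_gadj n (E : {set epair n}) w q : has_dense_set (gadj E) w q ->
  exists2 i, i \in dense_witnesses n w q & i.2 \subset E.
Proof.
case/existsP=> S /andP[Sw dense].
have : q <= #|E :&: inner_pairs S| by have := card_arcs_gadj E S; lia.
case/exists_subset_card => D; rewrite subsetI => /andP[DE DS] Dq.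
by exists (S, D); rewrite // inE Sw DS Dq /=.
Qed.

Section DenseSetProbability.
Local Open Scope ring_scope.
Import Order.TTheory GRing.Theory Num.Theory.

Lemma Pr_has_dense_set (R : realDomainType) (n w q : nat) (p : R) : 0 <= p <= 1 ->
  Pr p (fun E : {set epair n} => has_dense_set (gadj E) w q) <=
  ((n ^ w * 2 ^ (w * w))%N)%:R * p ^+ q.
Proof.
move=> p01; have /andP[p0 _] := p01.
apply: le_trans (Pr_first_moment p01 (@has_dense_set_gadj n ^~ w ^~ q)) _.
rewrite (eq_bigr (fun=> p ^+ q)) => [|i]; last by rewrite inE => /and3P[_ _ /eqP ->].
rewrite sumr_const -[leLHS]mulr_natl; apply: ler_wpM2r; first exact: exprn_ge0.
by rewrite ler_nat card_dense_witnesses.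
Qed.

End DenseSetProbability.

Section Placements.
Context {U : finType} {e : rel U} {s n : nat}.
Hypotheses (simple_e : simple_graph e) (room : #|U| * s <= n).

Local Notation placement := {ffun U -> 'I_s}.

(* Every vertex a of U has its own block of s nodes in 'I_n; the blocks are ordered as
   the ranks of their vertices, so that an edge whose ends are in the order of their
   ranks is placed on an epair. *)
Lemma node_subproof (a : U) (i : 'I_s) : enum_rank a * s + i < n.
Proof.
apply: leq_trans room; apply: (@leq_trans ((enum_rank a).+1 * s)).
  by rewrite mulSn addnC ltn_add2r.
by rewrite leq_mul2r ltn_ord orbT.
Qed.

Definition node (a : U) (i : 'I_s) : 'I_n := Ordinal (node_subproof a i).

Lemma node_inj a c i j : node a i = node c j -> a = c /\ i = j.
Proof.
move=> /(congr1 val) /= E; have s_gt0 : 0 < s by apply: leq_ltn_trans (ltn_ord i).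
have rank_eq : enum_rank a = enum_rank c.
  apply: val_inj; have := congr1 (fun m => m %/ s) E.
  by rewrite /= !divnMDl // !divn_small // !addn0.
split; first exact: enum_rank_inj.
by apply: val_inj; move: E; rewrite rank_eq => /addnI.
Qed.

Lemma ltn_node a c i j : enum_rank a < enum_rank c -> node a i < node c j.
Proof.
move=> ac /=; apply: (@leq_trans ((enum_rank a).+1 * s)).
  by rewrite mulSn addnC ltn_add2r.
by apply: leq_trans (leq_addr _ _); rewrite leq_mul2r ac orbT.
Qed.

Definition edge_of : finType := {d : U * U | (enum_rank d.1 < enum_rank d.2) && e d.1 d.2}.

Definition edges_in (A : {set U}) : {set edge_of} :=
  [set d | ((val d).1 \in A) && ((val d).2 \in A)].

Lemma placed_edge_subproof (x : placement) (d : edge_of) :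
  let q := (node (val d).1 (x (val d).1), node (val d).2 (x (val d).2)) in q.1 < q.2.
Proof. by apply: ltn_node; case/andP: (valP d). Qed.

Definition placed_edge (x : placement) (d : edge_of) : epair n :=
  exist (fun q : 'I_n * 'I_n => is_true (q.1 < q.2))
    (node (val d).1 (x (val d).1), node (val d).2 (x (val d).2)) (placed_edge_subproof x d).

Definition placed_edges (x : placement) : {set epair n} := placed_edge x @: [set: edge_of].

Definition agreement (x y : placement) : {set U} := [set a | x a == y a].

Lemma placed_edge_eq x y d d' : placed_edge x d = placed_edge y d' ->
  [/\ d = d', x (val d).1 = y (val d).1 & x (val d).2 = y (val d).2].
Proof.
move=> E; have E1 : node (val d).1 (x (val d).1) = node (val d').1 (y (val d').1).
  exact: (congr1 (fun u : epair n => (val u).1) E).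
have E2 : node (val d).2 (x (val d).2) = node (val d').2 (y (val d').2).
  exact: (congr1 (fun u : epair n => (val u).2) E).
have [[d1 x1] [d2 x2]] := (node_inj E1, node_inj E2).
have dd' : d = d' by apply: val_inj; rewrite [LHS]surjective_pairing d1 d2 -surjective_pairing.
by rewrite x1 x2 dd'.
Qed.

Lemma card_placed_edges x : #|placed_edges x| = #|edge_of|.
Proof. by rewrite card_imset ?cardsT // => d d' /placed_edge_eq[]. Qed.

Lemma card_placed_edgesI x y :
  #|placed_edges x :&: placed_edges y| = #|edges_in (agreement x y)|.
Proof.
have inj_x : injective (placed_edge x) by move=> d d' /placed_edge_eq[].
rewrite -(card_imset _ inj_x); apply: eq_card => u; rewrite inE.
apply/andP/imsetP => [[/imsetP[d _ ->] /imsetP[d' _ /placed_edge_eq[dd' e1 e2]]]|[d + ->]].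
  by exists d => //; rewrite !inE e1 e2 !eqxx.
rewrite !inE => /andP[/eqP e1 /eqP e2]; split; first exact: imset_f.
by apply/imsetP; exists d => //; apply: val_inj; rewrite /= e1 e2.
Qed.

Lemma card_placed_edgesU x y :
  #|placed_edges x :|: placed_edges y| = 2 * #|edge_of| - #|edges_in (agreement x y)|.
Proof.
rewrite -card_placed_edgesI; have := cardsUI (placed_edges x) (placed_edges y).
by rewrite !card_placed_edges; lia.
Qed.

Lemma card_arcs_edges_in (A : {set U}) : #|arcs e A| = 2 * #|edges_in A|.
Proof.
have [sym irr] := simple_e; pose up := [set d : U * U | enum_rank d.1 < enum_rank d.2].
pose swap (d : U * U) := (d.2, d.1).
have inj_swap : injective swap by move=> [a c] [a' c'] [-> ->].
have card_up : #|arcs e A :&: up| = #|edges_in A|.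
  rewrite -(card_imset (edges_in A) val_inj); apply: eq_card => d; rewrite !inE.
  apply/idP/imsetP => [/andP[/and3P[d1 d2 ed] lt_d]|[u + ->]].
    have dP : (enum_rank d.1 < enum_rank d.2) && e d.1 d.2 by rewrite lt_d.
    by exists (exist _ d dP); rewrite // inE d1.
  by rewrite inE => /andP[-> ->]; have /andP[-> ->] := valP u.
have card_down : #|arcs e A :\: up| = #|arcs e A :&: up|.
  rewrite -(card_imset (_ :&: _) inj_swap); apply: eq_card => -[a c]; rewrite !inE /=.
  apply/andP/imsetP => [[down /and3P[aA cA eac]]|[[c' a'] + [-> ->]]].
    exists (c, a) => //; rewrite !inE /= cA aA sym eac ltn_neqAle leqNgt down /= !andbT.
    by apply: contraTneq eac => /val_inj/enum_rank_inj->; rewrite irr.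
  by rewrite !inE /= => /andP[/and3P[-> -> ec'a'] lt_c'a']; rewrite -leqNgt ltnW // sym.
by rewrite -(cardsID up) card_down card_up mul2n addnn.
Qed.

Lemma gadj_node (x : placement) (E : {set epair n}) a c : placed_edges x \subset E ->
  e a c -> gadj E (node a (x a)) (node c (x c)).
Proof.
move=> sub; have [sym irr] := simple_e; have [gsym _] := gadj_simple E.
have up a' c' : enum_rank a' < enum_rank c' -> e a' c' ->
    gadj E (node a' (x a')) (node c' (x c')).
  move=> lt eac; have dP : (enum_rank (a', c').1 < enum_rank (a', c').2) && e (a', c').1 (a', c').2.
    by rewrite /= lt.
  apply/existsP; exists (placed_edge x (exist _ (a', c') dP)).
  by rewrite (subsetP sub) ?imset_f ?inE //= !eqxx.
move=> eac; have [lt|lt|/val_inj/enum_rank_inj ac] := ltngtP (enum_rank a) (enum_rank c).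
- exact: up.
- by rewrite gsym; apply: up; rewrite // sym.
- by rewrite ac irr in eac.
Qed.

Lemma card_agreeing (x : placement) (A : {set U}) :
  #|[set y : placement | A \subset agreement x y]| * s ^ #|A| = s ^ #|U|.
Proof.
pose choices a := if a \in A then pred1 (x a) else predT.
have -> : #|[set y : placement | A \subset agreement x y]| = #|family choices|.
  apply: eq_card => y; rewrite inE; apply/subsetP/familyP => agree a.
    rewrite /choices; case: ifP => // aA; have := agree a aA.
    by rewrite !inE eq_sym.
  by move=> aA; have := agree a; rewrite /choices aA !inE eq_sym.
rewrite card_family foldrE big_map big_enum /= (bigID (mem A)) /= big1 ?mul1n => [|a aA].
  rewrite (eq_bigr (fun=> s)) => [|a /negPf aA]; last by rewrite /choices aA card_ord.
  rewrite prod_nat_const -expnD -[in RHS](cardsC A) addnC; congr (_ ^ (_ + _)).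
  by apply: eq_card => a; rewrite !inE.
by rewrite /choices aA card1.
Qed.

Section PlacementProbability.
Local Open Scope ring_scope.
Import Order.TTheory GRing.Theory Num.Theory.
Context {R : realFieldType} {p L : R}.
Hypotheses (p_gt0 : 0 < p) (p_leq1 : p <= 1).

(* The covariance of two placements comes from a set A on which they agree. *)
Lemma placement_covariance (x y : placement) :
  p ^+ #|placed_edges x :|: placed_edges y| - p ^+ (2 * #|edge_of|) <=
  \sum_(A : {set U} | (0 < #|edges_in A|)%N)
     (A \subset agreement x y)%:R * p ^+ (2 * #|edge_of| - #|edges_in A|).
Proof.
have term_ge0 (A : {set U}) :
    0 <= (A \subset agreement x y)%:R * p ^+ (2 * #|edge_of| - #|edges_in A|).
  by rewrite mulr_ge0 ?exprn_ge0 ?ler0n // ltW.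
rewrite card_placed_edgesU; have [->|agree_edges] := posnP #|edges_in (agreement x y)|.
  by rewrite subn0 subrr; apply: sumr_ge0.
rewrite (bigD1 (agreement x y)) //= subxx mul1r lerD2l.
by apply: (@le_trans _ _ 0); [rewrite oppr_le0 exprn_ge0 ?ltW|apply: sumr_ge0].
Qed.

Lemma sum_agreeing (A : {set U}) :
  (\sum_(x : placement) \sum_(y : placement) (A \subset agreement x y)%:R) * s%:R ^+ #|A| =
  (s%:R ^+ #|U|) ^+ 2 :> R.
Proof.
rewrite mulr_suml (eq_bigr (fun=> s%:R ^+ #|U|)) => [|x _]; last first.
  rewrite -!natrX -natr_sum -natrM -(card_agreeing x A); congr ((_ * _)%:R).
  rewrite -sum1_card [RHS]big_mkcond; apply: eq_bigr => y _.
  by rewrite inE; case: (_ \subset _).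
by rewrite sumr_const card_ffun card_ord -[LHS]mulr_natl natrX expr2.
Qed.

Hypotheses (L_gt0 : 0 < L) (s_gt0 : (0 < s)%N).
Hypothesis many_copies : forall A : {set U}, (0 < #|edges_in A|)%N ->
  L <= s%:R ^+ #|A| * p ^+ #|edges_in A|.

Local Notation mu := (s%:R ^+ #|U| * p ^+ #|edge_of| : R).

Lemma placement_overlap (A : {set U}) : (0 < #|edges_in A|)%N ->
  \sum_(x : placement) \sum_(y : placement)
    (A \subset agreement x y)%:R * p ^+ (2 * #|edge_of| - #|edges_in A|) <= mu ^+ 2 / L.
Proof.
move=> A_edges; under eq_bigr => x _ do rewrite -mulr_suml.
rewrite -mulr_suml ler_pdivlMr //; set N := \sum_x _.
have N_ge0 : 0 <= N by apply: sumr_ge0 => x _; apply: sumr_ge0 => y _; apply: ler0n.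
have edges_leq : (#|edges_in A| <= 2 * #|edge_of|)%N.
  exact: leq_trans (max_card _) (leq_pmull _ _).
apply: (@le_trans _ _ (N * p ^+ (2 * #|edge_of| - #|edges_in A|) *
                        (s%:R ^+ #|A| * p ^+ #|edges_in A|))).
  by apply: ler_wpM2l (many_copies A_edges); rewrite mulr_ge0 // exprn_ge0 // ltW.
by rewrite mulrACA sum_agreeing -exprD subnK // (mulnC 2) exprM exprMn.
Qed.

Lemma sum_placement_covariance :
  \sum_(x : placement) \sum_(y : placement)
    (p ^+ #|placed_edges x :|: placed_edges y| - p ^+ (#|placed_edges x| + #|placed_edges y|)) <=
  2 ^+ #|U| / L * mu ^+ 2.
Proof.
apply: (@le_trans _ _ (\sum_(A : {set U} | (0 < #|edges_in A|)%N)
  \sum_(x : placement) \sum_(y : placement)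
    (A \subset agreement x y)%:R * p ^+ (2 * #|edge_of| - #|edges_in A|))).
  rewrite [leRHS]exchange_big /=; apply: ler_sum => x _.
  rewrite [leRHS]exchange_big /=; apply: ler_sum => y _.
  by rewrite !card_placed_edges addnn -mul2n placement_covariance.
apply: (@le_trans _ _ (\sum_(A : {set U}) mu ^+ 2 / L)).
  rewrite [leRHS](bigID (fun A : {set U} => (0 < #|edges_in A|)%N)) /=.
  rewrite -[leLHS]addr0; apply: lerD; first by apply: ler_sum => A; apply: placement_overlap.
  by apply: sumr_ge0 => A _; rewrite divr_ge0 ?sqr_ge0 // ltW.
have card_subsets : #|{set U}| = (2 ^ #|U|)%N.
  by rewrite -[in RHS]cardsT -card_powerset powersetT cardsT.
by rewrite sumr_const -[leLHS]mulr_natl card_subsets natrX mulrA mulrAC.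
Qed.

Lemma Pr_no_placement :
  Pr p (fun E => [forall x, ~~ (placed_edges x \subset E)]) <= 2 ^+ #|U| / L.
Proof.
have mu_gt0 : 0 < mu ^+ 2 by rewrite exprn_gt0 // mulr_gt0 ?exprn_gt0 // ltr0n.
have p01 : 0 <= p <= 1 by rewrite ltW.
rewrite -(ler_pM2r mu_gt0); apply: le_trans sum_placement_covariance.
apply: le_trans (Pr_second_moment p01 placed_edges).
have -> : mu = \sum_(x : placement) p ^+ #|placed_edges x|; last by [].
rewrite (eq_bigr (fun=> p ^+ #|edge_of|)) => [|x _]; last by rewrite card_placed_edges.
by rewrite sumr_const card_ffun card_ord -[RHS]mulr_natl natrX.
Qed.

End PlacementProbability.

End Placements.

(** * Asymptotics *)

Section Asymptotics.
Local Open Scope ring_scope.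
Import Order.TTheory GRing.Theory Num.Theory.

Lemma expected_dense_sets_leq (R : realFieldType) (v n w : nat) (p eps : R) :
  0 <= p -> 0 <= eps <= 1 -> (0 < n)%N -> (0 < w <= v)%N -> (1 < v)%N ->
  n%:R ^+ v * p ^+ v.-1 <= eps ^+ v.-1 ->
  n%:R ^+ w * p ^+ minn w v.-1 <= eps.
Proof.
move=> p0 /andP[eps0 eps1] n_gt0 /andP[w_gt0 le_v] v_gt1 rare.
have v'_gt0 : (0 < v.-1)%N by lia.
have eps_pow k : (0 < k)%N -> eps ^+ k <= eps.
  by move=> k_gt0; rewrite -[leRHS]expr1; apply: ler_wiXn2l.
have [lt_v|ge_v] := ltnP w v; last first.
  have [-> ->] : minn w v.-1 = v.-1 /\ w = v by lia.
  exact: le_trans rare (eps_pow _ v'_gt0).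
have np_eps : n%:R * p <= eps.
  rewrite -(ler_pXn2r v'_gt0) ?nnegrE ?mulr_ge0 ?ler0n //; apply: le_trans rare.
  by rewrite exprMn ler_wpM2r ?exprn_ge0 // ler_weXn2l ?ler1n ?leq_pred.
have -> : minn w v.-1 = w by lia.
rewrite -exprMn.
by apply: le_trans (eps_pow _ w_gt0); apply: lerXn2r; rewrite ?nnegrE ?mulr_ge0 ?ler0n.
Qed.

Lemma Pr_client_wins_sparse (R : realFieldType) (b : nat) (VH : finType) (eH : rel VH)
    x (v n : nat) (p eps : R) :
  winning_trees_geq b eH (component eH x) v -> (1 < v)%N -> (0 < n)%N ->
  0 <= p <= 1 -> 0 <= eps <= 1 -> n%:R ^+ v * p ^+ v.-1 <= eps ^+ v.-1 ->
  Pr p (fun E : {set epair n} => client_wins b eH setT (gadj E)) <=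
  (v * 2 ^ (v * v))%N%:R * eps.
Proof.
move=> min_v v_gt1 n_gt0 p01 eps01 rare; have /andP[p0 _] := p01.
pose dense (i : 'I_v) (E : {set epair n}) := has_dense_set (gadj E) i.+1 (minn i.+1 v.-1).
apply: (@le_trans _ _ (\sum_i Pr p (dense i))).
  apply: Pr_union => // E win.
  have [i] := client_wins_has_dense_set (gadj_simple E) (ltnW v_gt1) min_v win.
  by exists i.
apply: (@le_trans _ _ (\sum_(i < v) (2 ^ (v * v))%N%:R * eps)); last first.
  by rewrite sumr_const card_ord -[leLHS]mulr_natl natrM mulrA.
apply: ler_sum => i _; apply: le_trans (Pr_has_dense_set _ _ _ p01) _.
rewrite mulnC natrM -mulrA; apply: ler_pM.
- exact: ler0n.
- by rewrite mulr_ge0 ?ler0n ?exprn_ge0.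
- by rewrite ler_nat leq_exp2l // leq_mul.
- by rewrite natrX; apply: expected_dense_sets_leq rare => //=.
Qed.

(* Up to a constant, s^a p^m is the expected number of copies of a graph with a vertices
   and m edges; trees on v vertices have the largest admissible density m / a. *)
Lemma expected_copies_geq (R : realFieldType) (v s a m : nat) (p L : R) :
  (1 < v)%N -> 0 <= p -> 1 <= L -> (0 < s)%N -> (0 < m)%N -> (v * m <= v.-1 * a)%N ->
  L ^+ v.-1 <= s%:R ^+ v * p ^+ v.-1 -> L <= s%:R ^+ a * p ^+ m.
Proof.
move=> v_gt1 p0 L1 s_gt0 m_gt0 le_density; set K := s%:R ^+ v * p ^+ v.-1 => le_K.
have v'_gt0 : (0 < v.-1)%N by lia.
have L0 : 0 <= L := le_trans ler01 L1.
have K1 : 1 <= K by apply: le_trans le_K; apply: exprn_ege1.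
rewrite -(ler_pXn2r v'_gt0) ?nnegrE ?mulr_ge0 ?exprn_ge0 ?ler0n //; apply: le_trans le_K _.
apply: (@le_trans _ _ (K ^+ m)); first by rewrite -[leLHS]expr1; apply: ler_weXn2l.
rewrite /K !exprMn -!exprM [(v.-1 * m)%N]mulnC; apply: ler_wpM2r; first exact: exprn_ge0.
by apply: ler_weXn2l; rewrite ?ler1n // [(a * _)%N]mulnC.
Qed.

Lemma leq_divn_double (n d : nat) : (0 < d <= n)%N -> (n <= n %/ d * (2 * d))%N.
Proof.
case/andP=> d_gt0 le_d; have := divn_eq n d; have := ltn_pmod n d_gt0.
by have : (0 < n %/ d)%N by [rewrite divn_gt0]; nia.
Qed.

Lemma Pr_waiter_wins_dense (R : realFieldType) (b : nat) (VH U : finType) (eH : rel VH)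
    (e : VH -> rel U) : (1 < #|U|)%N -> simple_graph eH ->
  (forall x, winning_sparse_graph b eH (component eH x) (e x)) ->
  exists k : nat, forall (n : nat) (p L : R), 0 <= p <= 1 -> 1 <= L -> (k < n)%N ->
    L ^+ #|U|.-1 * (2 * k.+1)%N%:R ^+ #|U| <= n%:R ^+ #|U| * p ^+ #|U|.-1 ->
    Pr p (fun E : {set epair n} => ~~ client_wins b eH setT (gadj E)) <= 2 ^+ k / L.
Proof.
move=> v_gt1 simple_H win_e; have v'_gt0 : (0 < #|U|.-1)%N by lia.
have [|M enough_M] := @client_wins_blocks b VH U eH e simple_H.
  by move=> x; have [] := win_e x.
pose e_at (k : VH * 'I_M) := e k.1; pose eB := block_rel e_at.
have sparse_B k : sparse (e_at k) by have [] := win_e k.1.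
have simple_B : simple_graph eB.
  by apply: block_rel_simple => k; have [] := win_e k.1.
exists #|{: VH * 'I_M * U}| => n p L p01 L1; set k := #|_| => lt_n many.
have /andP[p0 p1] := p01; have L_gt0 : 0 < L := lt_le_trans ltr01 L1.
have c_gt0 : 0 < (2 * k.+1)%N%:R ^+ #|U| :> R by rewrite exprn_gt0 // ltr0n.
have p_gt0 : 0 < p.
  rewrite lt_def p0 andbT; apply: contraTneq many => ->.
  by rewrite expr0n (negPf (lt0n_neq0 v'_gt0)) mulr0 -ltNge mulr_gt0 // exprn_gt0.
have s_gt0 : (0 < n %/ k.+1)%N by rewrite divn_gt0.
have room : (k * (n %/ k.+1) <= n)%N.
  by apply: leq_trans (leq_divM n k.+1); rewrite mulnC leq_mul2l leqnSn orbT.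
apply: le_trans (Pr_no_placement (e := eB) room p_gt0 p1 L_gt0 s_gt0 _).
  apply: ler_Pr => // E; apply: contraR; rewrite negb_forall => /existsP[x].
  rewrite negbK => sub.
  apply: (enough_M _ _ (fun a => node room a (x a))) => [a c /node_inj[]|a c eac] //.
  exact: gadj_node sub eac.
move=> A A_edges; apply: (expected_copies_geq v_gt1 p0 L1 s_gt0 A_edges).
  have := block_rel_density A sparse_B.
  by rewrite -/eB (card_arcs_edges_in simple_B) mulnCA -mulnA leq_mul2l.
rewrite -(ler_pM2r c_gt0); apply: le_trans many _.
rewrite mulrAC -exprMn -natrM; apply: ler_wpM2r; first exact: exprn_ge0.
by apply: lerXn2r; rewrite ?nnegrE ?ler0n // ler_nat leq_divn_double.
Qed.

Lemma gnp_probE (n : nat) (p : R) (Q : pred {set epair n}) : gnp_prob p Q = Pr p Q.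
Proof.
rewrite /gnp_prob /Pr; apply: eq_bigr => E _.
by rewrite /bernoulli cardsT !RpowE.
Qed.

Lemma prob_bounds01 (p : nat -> R) n : prob_bounds p -> 0 <= p n <= 1.
Proof. by move=> /(_ n)[/RleP -> /RleP ->]. Qed.

Lemma whp_Pr (Q : forall n : nat, pred {set epair n}) (p : nat -> R) : prob_bounds p ->
  (forall eps : R, 0 < eps -> exists N : nat, forall n, (N <= n)%N ->
     Pr (p n) (predC (Q n)) <= eps) -> whp Q p.
Proof.
move=> p_bounds rare eps /RltP eps_gt0.
have [|N from_N] := rare (eps / 2); first by rewrite divr_gt0.
exists N => n /ssrnat.leP le_n; apply/RltP; rewrite RdistE gnp_probE Pr_predC.
have := Pr_ge0 (prob_bounds01 n p_bounds) (predC (Q n)); have := from_N n le_n.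
set P := Pr _ _ => le_P P_ge0.
have -> : 1 - P - R1 = - P by rewrite -[R1]/(1 : R) addrAC subrr sub0r.
by rewrite normrN ger0_norm // (le_lt_trans le_P) // ltr_pdivrMr // ltr_pMr // ltr1n.
Qed.

Lemma threshold_gt0 (v e n : nat) : 0 < threshold v e n.
Proof. by apply/RltP; apply: exp_pos. Qed.

Lemma threshold_power (v e n : nat) : (0 < e)%N -> (0 < n)%N ->
  n%:R ^+ v * threshold v e n ^+ e = 1.
Proof.
move=> e_gt0 n_gt0; have n_gt0R : Rlt R0 (INR n) by apply: lt_0_INR; apply/ssrnat.ltP.
have e_neq0R : INR e <> R0 by apply: not_0_INR; case: e e_gt0.
have -> : threshold v e n ^+ e = Rinv (INR n ^+ v).
  rewrite -!RpowE -Rpower_pow; last exact: exp_pos.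
  rewrite /threshold Rpower_mult -Rpower_pow // -Rpower_Ropp; congr Rpower.
  by rewrite /Rdiv Ropp_mult_distr_l_reverse Rmult_assoc Rinv_l // Rmult_1_r.
by rewrite INRE RinvE mulfV // expf_neq0 // pnatr_eq0 -lt0n.
Qed.

Lemma little_omega_threshold (v e : nat) (p : nat -> R) (K : R) : (0 < e)%N ->
  little_omega p (threshold v e) ->
  exists N : nat, forall n, (N <= n)%N -> K <= n%:R ^+ v * p n ^+ e.
Proof.
move=> e_gt0 p_large; pose M := Num.max 1 K.
have M1 : 1 <= M by rewrite le_max lexx.
have [|N from_N] := p_large M; first by apply/RltP; apply: lt_le_trans M1.
exists (maxn N 1) => n; rewrite geq_max => /andP[le_N n_gt0].
have /RleP : Rle (Rmult M (threshold v e n)) (p n) := from_N n le_N.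
rewrite RmultE => Mt_p; have t_ge0 := ltW (threshold_gt0 v e n).
have M0 : 0 <= M := le_trans ler01 M1.
apply: (@le_trans _ _ (M ^+ e)).
  by apply: (@le_trans _ _ M); [rewrite le_max lexx orbT|rewrite -[leLHS]expr1 ler_weXn2l].
rewrite -[leLHS]mulr1 -[X in _ * X <= _](threshold_power v e_gt0 n_gt0) mulrCA -exprMn.
apply: ler_wpM2l; first by rewrite exprn_ge0 ?ler0n.
by apply: lerXn2r; rewrite ?nnegrE // ?mulr_ge0 // (le_trans _ Mt_p) // mulr_ge0.
Qed.

Lemma little_o_threshold (v e : nat) (p : nat -> R) (eps : R) : (0 < e)%N ->
  (forall n, 0 <= p n) -> 0 < eps -> little_o p (threshold v e) ->
  exists N : nat, forall n, (N <= n)%N -> n%:R ^+ v * p n ^+ e <= eps ^+ e.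
Proof.
move=> e_gt0 p_ge0 eps_gt0 p_small; have [|N from_N] := p_small eps; first exact/RltP.
exists (maxn N 1) => n; rewrite geq_max => /andP[le_N n_gt0].
have /RleP := from_N n le_N; rewrite RmultE => p_et.
rewrite -[leRHS]mulr1 -[X in _ <= _ * X](threshold_power v e_gt0 n_gt0) mulrCA -exprMn.
apply: ler_wpM2l; first by rewrite exprn_ge0 ?ler0n.
by apply: lerXn2r; rewrite ?nnegrE // mulr_ge0 // ltW // threshold_gt0.
Qed.

Lemma client_loses_whp (b : nat) (VH : finType) (eH : rel VH) x (v : nat) (p : nat -> R) :
  winning_trees_geq b eH (component eH x) v -> (1 < v)%N -> prob_bounds p ->
  little_o p (threshold v v.-1) ->
  whp (fun n (E : {set epair n}) => ~~ client_wins b eH setT (gadj E)) p.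
Proof.
move=> min_v v_gt1 p_bounds p_small; apply: whp_Pr => // eps eps_gt0.
have v'_gt0 : (0 < v.-1)%N by lia.
set c : R := (v * 2 ^ (v * v))%N%:R.
have c_gt0 : 0 < c by rewrite ltr0n muln_gt0 expn_gt0 (ltnW v_gt1).
pose d : R := Num.min 1 (eps / c).
have d_gt0 : 0 < d by rewrite lt_min ltr01 divr_gt0.
have d01 : 0 <= d <= 1 by rewrite ltW // ge_min lexx.
have [|N from_N] := little_o_threshold v'_gt0 _ d_gt0 p_small.
  by move=> n; have /andP[] := prob_bounds01 n p_bounds.
exists (maxn N 1) => n; rewrite geq_max => /andP[le_N n_gt0].
have p01 := prob_bounds01 n p_bounds.
apply: (@le_trans _ _ (Pr (p n) (fun E : {set epair n} => client_wins b eH setT (gadj E)))).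
  by apply: ler_Pr => // E /=; rewrite negbK.
apply: le_trans (Pr_client_wins_sparse min_v v_gt1 n_gt0 p01 d01 (from_N n le_N)) _.
by rewrite mulrC -ler_pdivlMr // ge_min lexx orbT.
Qed.

Lemma client_wins_whp (b : nat) (VH U : finType) (eH : rel VH) (e : VH -> rel U)
    (p : nat -> R) : (1 < #|U|)%N -> simple_graph eH ->
  (forall x, winning_sparse_graph b eH (component eH x) (e x)) ->
  prob_bounds p -> little_omega p (threshold #|U| #|U|.-1) ->
  whp (fun n (E : {set epair n}) => client_wins b eH setT (gadj E)) p.
Proof.
move=> v_gt1 simple_H win_e p_bounds p_large; apply: whp_Pr => // eps eps_gt0.
have v'_gt0 : (0 < #|U|.-1)%N by lia.
have [k lose_k] := @Pr_waiter_wins_dense R b VH U eH e v_gt1 simple_H win_e.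
pose L : R := Num.max 1 (2 ^+ k / eps).
have L1 : 1 <= L by rewrite le_max lexx.
have L_gt0 : 0 < L := lt_le_trans ltr01 L1.
have [N from_N] := little_omega_threshold (L ^+ #|U|.-1 * (2 * k.+1)%N%:R ^+ #|U|) v'_gt0 p_large.
exists (maxn N k.+1) => n; rewrite geq_max => /andP[le_N lt_n].
apply: le_trans (lose_k n (p n) L (prob_bounds01 n p_bounds) L1 lt_n (from_N n le_N)) _.
by rewrite ler_pdivrMr // mulrC -ler_pdivrMr // le_max lexx orbT.
Qed.

End Asymptotics.

Theorem theorem10 :
  (* (1) trees *)
  (forall (b : nat) (VH : finType) (eH : rel VH),
      0 < b -> is_tree eH ->
      exists (VT : finType) (eT : rel VT), is_tree eT /\ client_wins b eH setT eT)
  /\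
  (* (2) forests in G(n,p) *)
  (forall (b : nat) (VH : finType) (eH : rel VH),
      0 < b -> is_forest eH -> (exists x y, eH x y) ->
      forall (VT : finType) (eT : rel VT),
        (* T_max: a minimum winning tree for some component ... *)
        (exists x : VH, min_winning_tree b eH (component eH x) eT) ->
        (* ... with the maximum number of vertices among these *)
        (forall (x : VH) (VT' : finType) (eT' : rel VT'),
            min_winning_tree b eH (component eH x) eT' -> #|VT'| <= #|VT|) ->
        forall p : nat -> R,
          prob_bounds p ->
          (little_omega p (threshold #|VT| (nedges eT)) ->
             whp (fun n E => client_wins b eH setT (gadj E)) p) /\
          (little_o p (threshold #|VT| (nedges eT)) ->
             whp (fun n E => ~~ client_wins b eH setT (gadj E)) p)).
Proof.
split=> [b VH eH _ tree_H|b VH eH _ forest_H [x0 [y0 exy]] VT eT [x minT] maxT p p_bounds].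
  exact: (exists_winning_tree (b := b) tree_H.1 (grown_tree tree_H)).
have small z := winning_tree_leq forest_H (maxT z).
have v_gt1 : 1 < #|VT|.
  have [VT0 [eT0 [[_ win0] le_v]]] := small x0.
  exact: leq_trans (winning_host_gt1 forest_H.1 exy win0) le_v.
have [tree_T _ minimal_T] := minT.
have -> : nedges eT = #|VT|.-1 by rewrite -(nedges_tree tree_T).
split; last first.
  apply: (client_loses_whp (x := x)) => // VT' eT' [tree_T' win_T'].
  exact: minimal_T tree_T' win_T'.
have padded z : exists e : rel 'I_#|VT|, winning_sparse_graph b eH (component eH z) e.
  by have [VT' [eT' [winT' le_v]]] := small z; apply: winning_tree_pad winT' le_v.
have [e win_e] := fin_all_exists padded.
have := @client_wins_whp b VH 'I_#|VT| eH e p; rewrite card_ord.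
by move/(_ v_gt1 forest_H.1 win_e p_bounds).
Qed.
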